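(* Let $G$ be an acyclic directed $st$-graph. The following are equivalent: (1) $G$ is vulnerable; (2) $G$ is not two-terminal series-parallel (TTSP); (3) $G$ is edge-weak; (4) $G$ has a subgraph (with the same source and sink) that is weak.
   Context: A directed $st$-graph $G=(V,E,s,t)$ is a finite directed graph with no self-loops and no parallel edges, with distinct source $s$ (no incoming edges) and sink $t$ (no outgoing edges), such that every vertex lies on some directed walk from $s$ to $t$; subgraphs keep $s,t$ and are themselves directed $st$-graphs. TTSP graphs are defined inductively: a single edge $(s,t)$ is TTSP; the series composition of TTSP graphs $G_1,G_2$ (identify the sink of $G_1$ with the source of $G_2$) and their parallel composition (identify the two sources and the two sinks) are TTSP. Weakness: a channel is $\eta:V\to\mathbb{N}\cup\{\infty\}$ with $\eta(s)=\eta(t)=\infty$; a flow for $\eta$ is a finitely supported $\phi$ from $s$–$t$ walks to $\mathbb{N}$ with $\sum_p m_v(p)\phi(p)\le\eta(v)$ ($m_v(p)$ = occurrences of $v$ in $p$); $\max_\eta$ is the maximum value $\sum_p\phi(p)$; $\phi$ inhibits $\eta$ if the residual charges admit no positive-value flow; $\min_\eta$ is the minimum value of an inhibiting flow; the graph is weak if $\min_\eta\ne\max_\eta$ for some $\eta$. Edge-weakness: for capacities $c:E\to\mathbb{R}_{\ge0}$, a flow $f:E\to\mathbb{R}_{\ge0}$ satisfies $f\le c$ and conservation at vertices other than $s,t$; it is saturating if every $s$–$t$ walk has an edge with $f(e)=c_e$; $G$ is edge-weak if some capacities admit a saturating flow of value strictly below the maximum flow value. Vulnerability: a flow is a finitely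 supported $\varphi\ge0$ on $s$–$t$ walks inducing edge flows $\varphi(e)$; latencies $l_e$ are continuous non-decreasing $\mathbb{R}_{\ge0}\to\mathbb{R}_{\ge0}$, $l_p(\varphi)=\sum_{e\in p}l_e(\varphi(e))$; $\varphi$ of value $r$ is a Wardrop flow for $(G,r,l)$ if $l_p(\varphi)\le l_q(\varphi)$ whenever $\varphi(p)>0$; $L(G,r,l)$ is the common latency of used paths ($0$ if $r=0$); $G$ is vulnerable if $L(G,r,l)>L(H,r,l|_H)$ for some $r$, $l$ and subgraph $H$. *)

(* Defs.v *)
From Stdlib Require Import Reals List Arith.
Import ListNotations.
Open Scope R_scope.

Record graph := mkG { gV : list nat; gE : list (nat * nat); gs : nat; gt : nat }.

Fixpoint walk_edges (p : list nat) : list (nat * nat) :=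
  match p with
  | x :: ((y :: _) as q) => (x, y) :: walk_edges q
  | _ => []
  end.

Definition is_walk (E : list (nat * nat)) (p : list nat) : Prop :=
  forall e, In e (walk_edges p) -> In e E.

Definition st_walk (G : graph) (p : list nat) : Prop :=
  is_walk (gE G) p /\ (exists q, p = gs G :: q) /\ last p (gs G) = gt G.

Definition st_graph (G : graph) : Prop :=
  NoDup (gV G) /\ NoDup (gE G) /\
  In (gs G) (gV G) /\ In (gt G) (gV G) /\ gs G <> gt G /\
  (forall u v, In (u, v) (gE G) -> In u (gV G) /\ In v (gV G) /\ u <> v) /\
  (forall u, ~ In (u, gs G) (gE G)) /\
  (forall v, ~ In (gt G, v) (gE G)) /\
  (forall v, In v (gV G) -> exists p, st_walk G p /\ In v p).

Definition acyclic (G : graph) : Prop :=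
  forall p, is_walk (gE G) p -> (2 <= length p)%nat -> hd 0%nat p = last p 0%nat -> False.

Definition subgraph (H G : graph) : Prop :=
  gs H = gs G /\ gt H = gt G /\ incl (gV H) (gV G) /\ incl (gE H) (gE G) /\ st_graph H.

(** * TTSP graphs (up to the order of the lists; vertex names are kept) *)
Inductive TTSP : graph -> Prop :=
| TTSP_edge : forall G,
    gs G <> gt G ->
    (forall v, In v (gV G) <-> v = gs G \/ v = gt G) ->
    (forall e, In e (gE G) <-> e = (gs G, gt G)) ->
    TTSP G
| TTSP_series : forall G1 G2 G,
    TTSP G1 -> TTSP G2 ->
    gt G1 = gs G2 ->
    (forall v, In v (gV G1) -> In v (gV G2) -> v = gt G1) ->
    gs G = gs G1 -> gt G = gt G2 ->
    (forall v, In v (gV G) <-> In v (gV G1) \/ In v (gV G2)) ->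
    (forall e, In e (gE G) <-> In e (gE G1) \/ In e (gE G2)) ->
    TTSP G
| TTSP_parallel : forall G1 G2 G,
    TTSP G1 -> TTSP G2 ->
    gs G1 = gs G2 -> gt G1 = gt G2 ->
    (forall v, In v (gV G1) -> In v (gV G2) -> v = gs G1 \/ v = gt G1) ->
    (forall e, In e (gE G1) -> In e (gE G2) -> False) ->
    gs G = gs G1 -> gt G = gt G1 ->
    (forall v, In v (gV G) <-> In v (gV G1) \/ In v (gV G2)) ->
    (forall e, In e (gE G) <-> In e (gE G1) \/ In e (gE G2)) ->
    TTSP G.

Definition sumN {A} (f : A -> nat) (l : list A) : nat :=
  fold_right (fun a acc => (f a + acc)%nat) 0%nat l.
Definition sumR {A} (f : A -> R) (l : list A) : R :=
  fold_right (fun a acc => f a + acc) 0 l.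

(** a channel: charges in N ∪ {∞} (None = ∞), infinite at s and t *)
Definition channel (G : graph) (eta : nat -> option nat) : Prop :=
  eta (gs G) = None /\ eta (gt G) = None.

Definition nflow (G : graph) (phi : list nat -> nat) (supp : list (list nat)) : Prop :=
  NoDup supp /\ (forall p, In p supp -> st_walk G p) /\
  (forall p, phi p <> 0%nat -> In p supp).

Definition nload (phi : list nat -> nat) (supp : list (list nat)) (v : nat) : nat :=
  sumN (fun p => (count_occ Nat.eq_dec p v * phi p)%nat) supp.

Definition nvalue (phi : list nat -> nat) (supp : list (list nat)) : nat :=
  sumN phi supp.

Definition fits (c : option nat) (n : nat) : Prop :=
  match c with None => True | Some k => (n <= k)%nat end.

Definition flow_for (G : graph) (eta : nat -> option nat)
  (phi : list nat -> nat) (supp : list (list nat)) : Prop :=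
  nflow G phi supp /\ forall v, In v (gV G) -> fits (eta v) (nload phi supp v).

Definition residual (eta : nat -> option nat) (phi : list nat -> nat)
  (supp : list (list nat)) : nat -> option nat :=
  fun v => match eta v with None => None | Some k => Some (k - nload phi supp v)%nat end.

Definition inhibits (G : graph) (eta : nat -> option nat)
  (phi : list nat -> nat) (supp : list (list nat)) : Prop :=
  flow_for G eta phi supp /\
  ~ (exists psi supp', flow_for G (residual eta phi supp) psi supp' /\
                       (0 < nvalue psi supp')%nat).

Definition is_max_eta (G : graph) (eta : nat -> option nat) (m : nat) : Prop :=
  (exists phi supp, flow_for G eta phi supp /\ nvalue phi supp = m) /\
  (forall phi supp, flow_for G eta phi supp -> (nvalue phi supp <= m)%nat).

Definition is_min_eta (G : graph) (eta : nat -> option nat) (m : nat) : Prop :=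
  (exists phi supp, inhibits G eta phi supp /\ nvalue phi supp = m) /\
  (forall phi supp, inhibits G eta phi supp -> (m <= nvalue phi supp)%nat).

Definition weak (G : graph) : Prop :=
  exists eta mn mx, channel G eta /\ is_min_eta G eta mn /\ is_max_eta G eta mx /\ mn <> mx.

Definition out_sum (G : graph) (f : nat * nat -> R) (v : nat) : R :=
  sumR f (filter (fun e => Nat.eqb (fst e) v) (gE G)).
Definition in_sum (G : graph) (f : nat * nat -> R) (v : nat) : R :=
  sumR f (filter (fun e => Nat.eqb (snd e) v) (gE G)).

Definition capacities (G : graph) (c : nat * nat -> R) : Prop :=
  forall e, In e (gE G) -> 0 <= c e.

Definition eflow (G : graph) (c f : nat * nat -> R) : Prop :=
  (forall e, In e (gE G) -> 0 <= f e <= c e) /\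
  (forall v, In v (gV G) -> v <> gs G -> v <> gt G -> in_sum G f v = out_sum G f v).

Definition evalue (G : graph) (f : nat * nat -> R) : R :=
  out_sum G f (gs G) - in_sum G f (gs G).

Definition saturating (G : graph) (c f : nat * nat -> R) : Prop :=
  forall p, st_walk G p -> exists e, In e (walk_edges p) /\ f e = c e.

Definition is_max_evalue (G : graph) (c : nat * nat -> R) (m : R) : Prop :=
  (exists f, eflow G c f /\ evalue G f = m) /\
  (forall f, eflow G c f -> evalue G f <= m).

Definition edge_weak (G : graph) : Prop :=
  exists c f m, capacities G c /\ eflow G c f /\ saturating G c f /\
                is_max_evalue G c m /\ evalue G f < m.

Definition rflow (G : graph) (phi : list nat -> R) (supp : list (list nat)) : Prop :=
  NoDup supp /\ (forall p, In p supp -> st_walk G p) /\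
  (forall p, phi p <> 0 -> In p supp) /\ (forall p, 0 <= phi p).

Definition ecount (e : nat * nat) (p : list nat) : nat :=
  length (filter (fun e' => andb (Nat.eqb (fst e) (fst e')) (Nat.eqb (snd e) (snd e')))
                 (walk_edges p)).

Definition edge_load (phi : list nat -> R) (supp : list (list nat)) (e : nat * nat) : R :=
  sumR (fun p => phi p * INR (ecount e p)) supp.

Definition latencies (G : graph) (l : nat * nat -> R -> R) : Prop :=
  forall e, In e (gE G) ->
    (forall x, 0 <= x -> 0 <= l e x) /\
    (forall x y, 0 <= x -> x <= y -> l e x <= l e y) /\
    (forall x, 0 <= x -> continue_in (l e) (fun y => 0 <= y) x).

Definition path_lat (l : nat * nat -> R -> R) (phi : list nat -> R)
  (supp : list (list nat)) (p : list nat) : R :=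
  sumR (fun e => l e (edge_load phi supp e)) (walk_edges p).

Definition wardrop (G : graph) (r : R) (l : nat * nat -> R -> R)
  (phi : list nat -> R) (supp : list (list nat)) : Prop :=
  rflow G phi supp /\ sumR phi supp = r /\
  (forall p q, In p supp -> 0 < phi p -> st_walk G q ->
     path_lat l phi supp p <= path_lat l phi supp q).

Definition is_L (G : graph) (r : R) (l : nat * nat -> R -> R) (x : R) : Prop :=
  exists phi supp, wardrop G r l phi supp /\
    (forall p, In p supp -> 0 < phi p -> path_lat l phi supp p = x) /\
    (r = 0 -> x = 0).

Definition vulnerable (G : graph) : Prop :=
  exists r l H x y, 0 <= r /\ latencies G l /\ subgraph H G /\
    is_L G r l x /\ is_L H r l y /\ y < x.

(* Main.v *)
Require Import Defs.
From Stdlib Require Import Reals List Arith.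
From Stdlib Require Import Lia Lra Permutation.
Import ListNotations.
Open Scope R_scope.

(** An acyclic [st]-graph arises from a single path from [s] to [t] by successively attaching ears,
    that is, paths that meet the graph built so far only in their end points. By induction on
    the series-parallel decomposition, attaching an ear to a TTSP graph yields a TTSP graph or
    creates a subdivided Wheatstone bridge: a path from an inner vertex of one of two parallel
    paths to an inner vertex of the other. Such a bridge carries, in each of the three models,
    Braess's paradox: the zigzag flow through the bridge blocks the two parallel paths.

    Conversely, on a TTSP graph two flows [f] and [g] can be compared along a single path: if
    the value of [f] is less than that of [g], some path has [f < g] on all its edges and
    inner vertices. This excludes saturating and inhibiting flows that are not maximal, and,
    with [f <= g] and [0 < g] in place of [f < g], increasing latencies. *)

(** * Paths *)

(** The critical ear leaps over the junction of a series composition: no factor contains both its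
    ends, so the induction hypothesis says nothing about it. It is parallel to a stretch of the
    composition if each of its ends is a terminal of its factor or a series junction inside it;
    otherwise some path through that factor avoids the end, and this path completes the bridge. An
    ear directed backwards would fit neither case; acyclicity excludes it.

    Only the vertex model needs a subgraph. Off the bridge, capacities can be 0 and latencies large,
    but a channel bounds vertices and cannot close an edge of [G] that leads around the two charged
    vertices.

    Conversely, a subgraph [H] of a TTSP graph [G] is never shown to be TTSP. Its flows are compared
    inside [G], and the path obtained lies in [H] because every edge of it is loaded by a flow of
    [H]. For vulnerability this explains the extra condition [0 < g]: without it the path could
    leave [H], and nothing would bound its latency by that of the used paths. *)

(* The vertices of the path are [x :: q], so that concatenation of paths is
   concatenation of the lists [q]. *)
Inductive path (E : list (nat * nat)) : nat -> list nat -> nat -> Prop :=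
| path_nil x : path E x [] x
| path_cons x y q z : In (x, y) E -> path E y q z -> path E x (y :: q) z.

#[local] Hint Constructors path : core.

Section Paths.
Variable E : list (nat * nat).

Lemma path_nil_eq x y : path E x [] y -> x = y.
Proof. intros H; now inversion H. Qed.

Lemma path_cons_inv x y q z : path E x (y :: q) z -> In (x, y) E /\ path E y q z.
Proof. intros H; now inversion H. Qed.

Lemma path_one x y : In (x, y) E -> path E x [y] y.
Proof. eauto. Qed.

Lemma path_app x q1 y q2 z : path E x q1 y -> path E y q2 z -> path E x (q1 ++ q2) z.
Proof. induction 1; simpl; eauto. Qed.

Lemma path_app_inv x q1 q2 z :
  path E x (q1 ++ q2) z -> exists y, path E x q1 y /\ path E y q2 z.
Proof.
  revert x; induction q1 as [|a q1 IH]; simpl; intros x H; [eauto|].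
  apply path_cons_inv in H as [H1 H2]. destruct (IH _ H2) as (y & ? & ?); eauto.
Qed.

Lemma path_last x q y d : path E x q y -> last (x :: q) d = y.
Proof.
  intros H; induction H as [|x a q z Ha H IH]; [reflexivity|exact IH].
Qed.

Lemma path_end_in x q y : path E x q y -> In y (x :: q).
Proof. induction 1 as [|x a q z Ha H IH]; simpl in *; tauto. Qed.

Lemma path_end_tail x q y : path E x q y -> x <> y -> In y q.
Proof. intros H N. destruct (path_end_in _ _ _ H); [easy|auto]. Qed.

Lemma path_split x q y v : path E x q y -> In v (x :: q) ->
  exists q1 q2, q = q1 ++ q2 /\ path E x q1 v /\ path E v q2 y.
Proof.
  induction 1 as [x|x a q z Ha H IH]; intros Hv.
  - destruct Hv as [<-|[]]. exists [], []; auto.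
  - destruct Hv as [<-|Hv]; [exists [], (a :: q); eauto|].
    destruct (IH Hv) as (q1 & q2 & -> & ? & ?). exists (a :: q1), q2; eauto.
Qed.

Lemma path_split_tail x q y v : path E x q y -> In v q ->
  exists q1 q2, q = q1 ++ v :: q2 /\ path E x (q1 ++ [v]) v /\ path E v q2 y.
Proof.
  induction 1 as [x|x a q z Ha H IH]; intros Hv; [easy|].
  destruct Hv as [<-|Hv]; [exists [], q; simpl; auto|].
  destruct (IH Hv) as (q1 & q2 & -> & ? & ?). exists (a :: q1), q2; simpl; eauto.
Qed.

Lemma path_edges x q y e : path E x q y -> In e (walk_edges (x :: q)) -> In e E.
Proof.
  induction 1 as [x|x a q z Ha H IH]; [easy|].
  intros [<-|He]; auto.
Qed.

Lemma path_in_edge x q y v : path E x q y -> In v q -> exists u, In (u, v) E.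
Proof.
  induction 1 as [x|x a q z Ha H IH]; intros Hv; [easy|].
  destruct Hv as [<-|Hv]; eauto.
Qed.

Lemma path_edge_split x q y u v : path E x q y -> In (u, v) (walk_edges (x :: q)) ->
  exists q1 q2, q = q1 ++ v :: q2 /\ path E x q1 u /\ path E v q2 y.
Proof.
  induction 1 as [x|x a q z Ha H IH]; intros Hv; [easy|].
  destruct Hv as [Hv|Hv].
  - injection Hv as <- <-. exists [], q; auto.
  - destruct (IH Hv) as (q1 & q2 & -> & ? & ?). exists (a :: q1), q2; simpl; eauto.
Qed.

Lemma walk_edges_app x q1 y q2 : path E x q1 y ->
  walk_edges (x :: q1 ++ q2) = walk_edges (x :: q1) ++ walk_edges (y :: q2).
Proof.
  induction 1 as [x|x a q z Ha H IH]; [reflexivity|].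
  change ((x, a) :: walk_edges (a :: q ++ q2)
          = ((x, a) :: walk_edges (a :: q)) ++ walk_edges (z :: q2)).
  now rewrite IH.
Qed.

Lemma walk_edges_vertices p u v : In (u, v) (walk_edges p) -> In u p /\ In v (tl p).
Proof.
  induction p as [|x [|y p] IH]; [easy|easy|].
  intros [H|H]; [injection H as <- <-; simpl; auto|].
  destruct (IH H); simpl in *; tauto.
Qed.


Lemma is_walk_path x q : is_walk E (x :: q) -> path E x q (last (x :: q) x).
Proof.
  revert x; induction q as [|a q IH]; intros x H; [constructor|].
  constructor; [apply H; now left|].
  replace (last (x :: a :: q) x) with (last (a :: q) a).
  - apply IH. intros e He. apply H. now right.
  - clear. change (last (x :: a :: q) x) with (last (a :: q) x).
    revert a; induction q as [|b q IH]; intros a; [reflexivity|].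
    change (last (b :: q) a = last (b :: q) x).
    clear. revert b. induction q as [|c q IH]; intros b; [reflexivity|exact (IH c)].
Qed.

Lemma path_is_walk x q y : path E x q y -> is_walk E (x :: q).
Proof. intros H e He; eauto using path_edges. Qed.

(** Together with [first_hit], this trims a path until it meets a set only in its ends; ears and
    bridges are both obtained by such trimming. In [first_hit], the clause on edges serves to show
    that the trimmed path shares no edge with a graph on the vertex set [D]. *)
Lemma last_hit (D : nat -> Prop) (Ddec : forall x, {D x} + {~ D x}) x q y :
  path E x q y -> D x ->
  exists z q1 q2, q = q1 ++ q2 /\ path E x q1 z /\ path E z q2 y /\ D z /\
    forall w, In w q2 -> ~ D w.
Proof.
  intros H; revert x y H.
  induction q as [|a q IH] using rev_ind; intros x y H Hx.
  - exists x, [], []; repeat split; auto.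
  - apply path_app_inv in H as (z & H1 & H2).
    assert (a = y) as -> by (apply path_cons_inv in H2 as [_ H2]; now apply path_nil_eq in H2).
    destruct (Ddec y) as [Dy|Dy].
    + exists y, (q ++ [y]), []; rewrite app_nil_r; repeat split; eauto using path_app.
    + destruct (IH _ _ H1 Hx) as (w & q1 & q2 & -> & P1 & P2 & Dw & Hq).
      exists w, q1, (q2 ++ [y]); rewrite app_assoc; repeat split; eauto using path_app.
      intros v Hv; apply in_app_iff in Hv as [Hv|[<-|[]]]; auto.
Qed.

Lemma first_hit (D : nat -> Prop) (Ddec : forall x, {D x} + {~ D x}) x q y :
  path E x q y -> D y ->
  exists z q1 q2, q = q1 ++ q2 /\ path E x q1 z /\ path E z q2 y /\ D z /\
    (forall w, In w (x :: q1) -> D w -> w = z) /\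
    (forall e, In e (walk_edges (x :: q1)) -> ~ D (fst e)).
Proof.
  induction 1 as [x|x a q z Ha H IH]; intros Hy.
  - exists x, [], []; repeat split; auto. intros w [<-|[]]; auto.
  - destruct (Ddec x) as [Dx|Dx].
    + exists x, [], (a :: q); repeat split; eauto. intros w [<-|[]]; auto.
    + destruct (IH Hy) as (w & q1 & q2 & -> & P1 & P2 & Dw & Hq & He).
      exists w, (a :: q1), q2; repeat split; eauto.
      * intros v [<-|Hv]; [tauto|auto].
      * intros e [<-|Hv]; auto.
Qed.

Lemma path_vertices (V : list nat) x q y :
  (forall u v, In (u, v) E -> In v V) -> path E x q y -> forall v, In v q -> In v V.
Proof.
  intros HE H v Hv. destruct (path_in_edge _ _ _ _ H Hv) as [u Hu]. eauto.
Qed.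

End Paths.

Lemma path_incl E E' x q y : incl E E' -> path E x q y -> path E' x q y.
Proof. intros HE; induction 1; constructor; auto. Qed.

(** Moves a path to a subgraph: after this step, only its own edges have to be located there. *)
Lemma path_self E x q y : path E x q y -> path (walk_edges (x :: q)) x q y.
Proof.
  induction 1 as [x|x a q z Ha H IH]; [auto|].
  constructor; [now left|].
  refine (path_incl _ _ _ _ _ _ IH). intros e He; now right.
Qed.

(** * Acyclicity *)

Definition no_cycle (E : list (nat * nat)) : Prop := forall x q, path E x q x -> q = [].

Lemma acyclic_no_cycle G : acyclic G -> no_cycle (gE G).
Proof.
  intros H x [|a q] Hp; [reflexivity|exfalso].
  apply (H (x :: a :: q)).
  - eapply path_is_walk; eauto.
  - simpl; lia.
  - rewrite (path_last _ _ _ _ 0%nat Hp). reflexivity.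
Qed.

Lemma no_cycle_antisym E x q y q' :
  no_cycle E -> path E x q y -> path E y q' x -> x = y.
Proof.
  intros HC H H'. pose proof (HC _ _ (path_app _ _ _ _ _ _ H H')) as Hn.
  apply app_eq_nil in Hn as [-> _]. now apply path_nil_eq in H.
Qed.

Lemma no_cycle_tail E x q y : no_cycle E -> path E x q y -> ~ In x q.
Proof.
  intros HC H Hx. destruct (path_split_tail _ _ _ _ _ H Hx) as (q1 & q2 & -> & P1 & _).
  apply HC in P1. now destruct q1.
Qed.

Lemma no_cycle_NoDup E x q y : no_cycle E -> path E x q y -> NoDup (x :: q).
Proof.
  intros HC H. induction H as [x|x a q z Ha H IH].
  - repeat constructor; simpl; tauto.
  - constructor; [|exact IH]. eapply no_cycle_tail; eauto.
Qed.

Lemma st_walk_path G p :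
  st_walk G p <-> exists q, p = gs G :: q /\ path (gE G) (gs G) q (gt G).
Proof.
  split.
  - intros (Hw & (q & ->) & Hl). exists q. split; [reflexivity|].
    rewrite <- Hl. now apply is_walk_path.
  - intros (q & -> & H). repeat split; eauto using path_is_walk, path_last.
Qed.

(** * TTSP graphs *)

(** The conditions of [st_graph] without [NoDup], since [TTSP] reads the lists as sets. The walk
    through a vertex is split into two halves, which extend separately under composition. *)
Record TTSP_facts (G : graph) : Prop := {
  ttsp_st : gs G <> gt G;
  ttsp_s : In (gs G) (gV G);
  ttsp_t : In (gt G) (gV G);
  ttsp_dom : forall u v, In (u, v) (gE G) -> In u (gV G);
  ttsp_cod : forall u v, In (u, v) (gE G) -> In v (gV G);
  ttsp_loop : forall u, ~ In (u, u) (gE G);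
  ttsp_src : forall u, ~ In (u, gs G) (gE G);
  ttsp_snk : forall v, ~ In (gt G, v) (gE G);
  ttsp_from : forall v, In v (gV G) -> exists q, path (gE G) (gs G) q v;
  ttsp_to : forall v, In v (gV G) -> exists q, path (gE G) v q (gt G) }.

Lemma incl_of_iff_l {A} (l1 l2 l : list A) :
  (forall x, In x l <-> In x l1 \/ In x l2) -> incl l1 l.
Proof. intros H x Hx. apply H. now left. Qed.

Lemma incl_of_iff_r {A} (l1 l2 l : list A) :
  (forall x, In x l <-> In x l1 \/ In x l2) -> incl l2 l.
Proof. intros H x Hx. apply H. now right. Qed.

#[local] Hint Resolve ttsp_st ttsp_s ttsp_t ttsp_dom ttsp_cod ttsp_loop ttsp_src ttsp_snk
  ttsp_from ttsp_to incl_of_iff_l incl_of_iff_r : core.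

Lemma TTSP_wf G : TTSP G -> TTSP_facts G.
Proof.
  induction 1 as [G Hst HV HE
    |G1 G2 G T1 F1 T2 F2 Hm Hint Hs Ht HV HE
    |G1 G2 G T1 F1 T2 F2 Hs12 Ht12 Hint Hdis Hs Ht HV HE].
  - assert (P : path (gE G) (gs G) [gt G] (gt G)) by (apply path_one; now apply HE).
    split; auto.
    + now apply HV; left.
    + now apply HV; right.
    + intros u v Huv. apply HE in Huv. injection Huv as -> ->. now apply HV; left.
    + intros u v Huv. apply HE in Huv. injection Huv as -> ->. now apply HV; right.
    + intros u Hu. apply HE in Hu. congruence.
    + intros u Hu. apply HE in Hu. congruence.
    + intros u Hu. apply HE in Hu. congruence.
    + intros v Hv. apply HV in Hv as [->| ->]; eauto.
    + intros v Hv. apply HV in Hv as [->| ->]; eauto.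
  - assert (I1 : incl (gE G1) (gE G)) by eauto.
    assert (I2 : incl (gE G2) (gE G)) by eauto.
    assert (Hm1 : In (gs G2) (gV G1)) by (rewrite <- Hm; auto).
    destruct (ttsp_from _ F1 _ (ttsp_t _ F1)) as [q1 Q1].
    destruct (ttsp_from _ F2 _ (ttsp_t _ F2)) as [q2 Q2].
    split; rewrite ?Hs, ?Ht.
    + intros Heq. apply (ttsp_st _ F1). apply Hint; auto. rewrite Heq; auto.
    + apply HV; left; auto.
    + apply HV; right; auto.
    + intros u v Huv; apply HV; apply HE in Huv as [Huv|Huv]; eauto.
    + intros u v Huv; apply HV; apply HE in Huv as [Huv|Huv]; eauto.
    + intros u Huv; apply HE in Huv as [Huv|Huv];
        [exact (ttsp_loop _ F1 _ Huv)|exact (ttsp_loop _ F2 _ Huv)].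
    + intros u Huv; apply HE in Huv as [Huv|Huv]; [exact (ttsp_src _ F1 _ Huv)|].
      apply (ttsp_st _ F1), Hint; eauto.
    + intros u Huv; apply HE in Huv as [Huv|Huv]; [|exact (ttsp_snk _ F2 _ Huv)].
      assert (gt G2 = gt G1) by (apply Hint; eauto).
      apply (ttsp_st _ F2); congruence.
    + intros v Hv; apply HV in Hv as [Hv|Hv].
      * destruct (ttsp_from _ F1 _ Hv) as [q Q]. eauto using path_incl.
      * destruct (ttsp_from _ F2 _ Hv) as [q Q]. exists (q1 ++ q).
        apply (path_app _ _ _ (gs G2)); [rewrite <- Hm|]; eauto using path_incl.
    + intros v Hv; apply HV in Hv as [Hv|Hv].
      * destruct (ttsp_to _ F1 _ Hv) as [q Q]. exists (q ++ q2).
        apply (path_app _ _ _ (gs G2)); [rewrite <- Hm|]; eauto using path_incl.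
      * destruct (ttsp_to _ F2 _ Hv) as [q Q]. eauto using path_incl.
  - assert (I1 : incl (gE G1) (gE G)) by eauto.
    assert (I2 : incl (gE G2) (gE G)) by eauto.
    split; rewrite ?Hs, ?Ht.
    + auto.
    + apply HV; left; auto.
    + apply HV; left; auto.
    + intros u v Huv; apply HV; apply HE in Huv as [Huv|Huv]; eauto.
    + intros u v Huv; apply HV; apply HE in Huv as [Huv|Huv]; eauto.
    + intros u Huv; apply HE in Huv as [Huv|Huv];
        [exact (ttsp_loop _ F1 _ Huv)|exact (ttsp_loop _ F2 _ Huv)].
    + intros u Huv; apply HE in Huv as [Huv|Huv];
        [|rewrite Hs12 in Huv]; [exact (ttsp_src _ F1 _ Huv)|exact (ttsp_src _ F2 _ Huv)].
    + intros u Huv; apply HE in Huv as [Huv|Huv];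
        [|rewrite Ht12 in Huv]; [exact (ttsp_snk _ F1 _ Huv)|exact (ttsp_snk _ F2 _ Huv)].
    + intros v Hv; apply HV in Hv as [Hv|Hv].
      * destruct (ttsp_from _ F1 _ Hv) as [q Q]. eauto using path_incl.
      * destruct (ttsp_from _ F2 _ Hv) as [q Q]. rewrite Hs12. eauto using path_incl.
    + intros v Hv; apply HV in Hv as [Hv|Hv].
      * destruct (ttsp_to _ F1 _ Hv) as [q Q]. eauto using path_incl.
      * destruct (ttsp_to _ F2 _ Hv) as [q Q]. rewrite Ht12. eauto using path_incl.
Qed.

#[local] Hint Resolve TTSP_wf : core.

Lemma TTSP_ext G G' : TTSP G -> gs G' = gs G -> gt G' = gt G ->
  (forall v, In v (gV G') <-> In v (gV G)) -> (forall e, In e (gE G') <-> In e (gE G)) ->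
  TTSP G'.
Proof.
  intros T Hs Ht HV HE. destruct T as [G Hst HV' HE'
    |G1 G2 G T1 T2 Hm Hint Hs' Ht' HV' HE'
    |G1 G2 G T1 T2 Hs12 Ht12 Hint Hdis Hs' Ht' HV' HE'].
  - apply TTSP_edge; rewrite ?Hs, ?Ht; auto.
    + intros v; rewrite HV; auto.
    + intros v; rewrite HE; auto.
  - apply (TTSP_series G1 G2); try congruence; auto.
    + intros v; rewrite HV; auto.
    + intros v; rewrite HE; auto.
  - apply (TTSP_parallel G1 G2); try congruence; auto.
    + intros v; rewrite HV; auto.
    + intros v; rewrite HE; auto.
Qed.

(** * Ears and Wheatstone bridges *)

Definition add_ear (G : graph) (x : nat) (q : list nat) : graph :=
  mkG (gV G ++ x :: q) (gE G ++ walk_edges (x :: q)) (gs G) (gt G).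

Definition ear_graph (x : nat) (q : list nat) (y : nat) : graph :=
  mkG (x :: q) (walk_edges (x :: q)) x y.

(** The path lives in the graph of its own edges, so that being an ear is inherited by every smaller
    [V] and [E] ([ear_incl]). The last field matters for an ear of a single edge, which has no inner
    vertex to tell it from an edge already present. *)
Record ear (V : list nat) (E : list (nat * nat)) (x : nat) (q : list nat) (y : nat) : Prop := {
  ear_path : path (walk_edges (x :: q)) x q y;
  ear_NoDup : NoDup (x :: q);
  ear_neq : x <> y;
  ear_inner : forall v, In v (x :: q) -> In v V -> v = x \/ v = y;
  ear_edges : forall e, In e (walk_edges (x :: q)) -> ~ In e E }.

Lemma ear_incl V V' E E' x q y :
  incl V V' -> incl E E' -> ear V' E' x q y -> ear V E x q y.
Proof. intros HV HE [H1 H2 H3 H4 H5]. split; auto. intros e He He'; eapply H5; eauto. Qed.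

Lemma TTSP_path E x q y : path E x q y -> NoDup (x :: q) -> x <> y -> TTSP (ear_graph x q y).
Proof.
  induction 1 as [x|x a q z Ha H IH]; intros ND N; [easy|].
  inversion ND as [|? ? Hx ND']; subst.
  destruct (Nat.eq_dec a z) as [->|N'].
  - destruct q as [|b q].
    + apply TTSP_edge; simpl; auto.
      * intros v; split; [intros [<-|[<-|[]]]|intros [->| ->]]; auto.
      * intros e; split; [intros [<-|[]]|intros ->]; auto.
    + exfalso. apply path_cons_inv in H as [_ H].
      inversion ND' as [|? ? Hz _]; subst. apply Hz. exact (path_end_in _ _ _ _ H).
  - apply (TTSP_series (mkG [x; a] [(x, a)] x a) (ear_graph a q z)); simpl; auto.
    + apply TTSP_edge; simpl.
      * intros ->; simpl in Hx; tauto.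
      * intros v; split; [intros [<-|[<-|[]]]|intros [->| ->]]; auto.
      * intros e; split; [intros [<-|[]]|intros ->]; auto.
    + intros v [<-|[<-|[]]]; auto. simpl in Hx; tauto.
    + tauto.
    + intros e. tauto.
Qed.

(* [P] and [Q] omit the common first vertex [a]. In an acyclic graph this is a subdivided
   Wheatstone bridge: [M] may meet the two other paths, but its part from its last vertex on
   [P] to its next vertex on [Q] does not. *)
Definition wheatstone (E : list (nat * nat)) : Prop :=
  exists a b P Q u v M,
    path E a P b /\ path E a Q b /\ (forall z, In z P -> In z Q -> z = b) /\
    In u P /\ u <> b /\ In v Q /\ v <> b /\ path E u M v.

Lemma wheatstone_incl E E' : incl E E' -> wheatstone E -> wheatstone E'.
Proof.
  intros HE (a & b & P & Q & u & v & M & HP & HQ & Hd & Hu & Hub & Hv & Hvb & HM).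
  exists a, b, P, Q, u, v, M; repeat split; eauto using path_incl.
Qed.

(** * Series decompositions and cut vertices *)

Definition is_series (G1 G2 G : graph) : Prop :=
  gt G1 = gs G2 /\ (forall v, In v (gV G1) -> In v (gV G2) -> v = gt G1) /\
  gs G = gs G1 /\ gt G = gt G2 /\
  (forall v, In v (gV G) <-> In v (gV G1) \/ In v (gV G2)) /\
  (forall e, In e (gE G) <-> In e (gE G1) \/ In e (gE G2)).

Lemma TTSP_is_series G1 G2 G : TTSP G1 -> TTSP G2 -> is_series G1 G2 G -> TTSP G.
Proof. intros T1 T2 (H1 & H2 & H3 & H4 & H5 & H6). now apply (TTSP_series G1 G2). Qed.

Definition graph_join (G1 G2 : graph) : graph :=
  mkG (gV G1 ++ gV G2) (gE G1 ++ gE G2) (gs G1) (gt G2).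

Lemma TTSP_path_vertices G x y q :
  TTSP G -> path (gE G) x q y -> In x (gV G) -> forall v, In v (x :: q) -> In v (gV G).
Proof.
  intros T H Hx v [<-|Hv]; [exact Hx|].
  eapply path_vertices; eauto.
Qed.

(** In a parallel composition the other factor supplies a path around [x]. In a series composition
    either [x] is the junction, or the induction hypothesis applies to the factor of [x]: an
    avoiding path is extended through the other factor, and a decomposition at [x] is
    reassociated. *)
Lemma TTSP_cut_vertex G : TTSP G -> forall x, In x (gV G) -> x <> gs G -> x <> gt G ->
  (exists q, path (gE G) (gs G) q (gt G) /\ ~ In x (gs G :: q)) \/
  (exists G1 G2, TTSP G1 /\ TTSP G2 /\ is_series G1 G2 G /\ gt G1 = x).
Proof.
  induction 1 as [G Hst HV HE
    |G1 G2 G T1 IH1 T2 IH2 Hm Hint Hs Ht HV HE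
    |G1 G2 G T1 IH1 T2 IH2 Hs12 Ht12 Hint Hdis Hs Ht HV HE]; intros x Hx Nxs Nxt.
  - apply HV in Hx as [->| ->]; easy.
  - assert (I1 : incl (gE G1) (gE G)) by eauto.
    assert (I2 : incl (gE G2) (gE G)) by eauto.
    destruct (ttsp_from _ (TTSP_wf _ T1) (gt G1)) as [r1 R1]; auto.
    destruct (ttsp_from _ (TTSP_wf _ T2) (gt G2)) as [r2 R2]; auto.
    destruct (Nat.eq_dec x (gt G1)) as [->|Nm].
    { right. exists G1, G2. repeat split; auto; intros; try apply HV; try apply HE; auto. }
    apply HV in Hx as [Hx|Hx].
    + assert (Hx2 : ~ In x (gV G2)) by (intros Hx2; auto).
      destruct (IH1 x Hx) as [(q & Q & Nq)|(Ga & Gb & Ta & Tb & (S1 & S2 & S3 & S4 & S5 & S6) & Sx)];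
        [congruence|auto| |].
      * left. exists (q ++ r2). rewrite Hs, Ht. split.
        { apply (path_app _ _ _ (gs G2)); [rewrite <- Hm|]; eauto using path_incl. }
        intros [Hq|Hq]; [apply Nq; now left|]. apply in_app_iff in Hq as [Hq|Hq].
        { apply Nq; now right. }
        apply Hx2. eapply TTSP_path_vertices; eauto. now right.
      * right. exists Ga, (graph_join Gb G2).
        assert (Tj : TTSP (graph_join Gb G2)).
        { apply (TTSP_series Gb G2); simpl; auto using in_app_iff; try congruence.
          intros v Hv Hv2. rewrite <- S4. apply Hint; auto. apply S5; auto. }
        repeat split; simpl; auto; try congruence.
        -- intros v Hv Hv'. apply in_app_iff in Hv' as [Hv'|Hv']; auto.
           assert (v = gt G1) as -> by (apply Hint; auto; apply S5; auto).
           apply S2; auto. rewrite S4. auto.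
        -- rewrite HV, S5, in_app_iff; tauto.
        -- rewrite HV, S5, in_app_iff; tauto.
        -- rewrite HE, S6, in_app_iff; tauto.
        -- rewrite HE, S6, in_app_iff; tauto.
    + assert (Hx1 : ~ In x (gV G1)) by (intros Hx1; auto).
      destruct (IH2 x Hx) as [(q & Q & Nq)|(Ga & Gb & Ta & Tb & (S1 & S2 & S3 & S4 & S5 & S6) & Sx)];
        [congruence|congruence| |].
      * left. exists (r1 ++ q). rewrite Hs, Ht. split.
        { apply (path_app _ _ _ (gs G2)); [rewrite <- Hm|]; eauto using path_incl. }
        intros Hq. change (In x ((gs G1 :: r1) ++ q)) in Hq. apply in_app_iff in Hq as [Hq|Hq].
        { apply Hx1. eapply TTSP_path_vertices; eauto. }
        apply Nq; now right.
      * right. exists (graph_join G1 Ga), Gb.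
        assert (Tj : TTSP (graph_join G1 Ga)).
        { apply (TTSP_series G1 Ga); simpl; auto using in_app_iff; try congruence.
          intros v Hv Hv2. apply Hint; auto. apply S5; auto. }
        repeat split; simpl; auto; try congruence.
        -- intros v Hv' Hv. apply in_app_iff in Hv' as [Hv'|Hv']; auto.
           assert (v = gt G1) as -> by (apply Hint; auto; apply S5; auto).
           apply S2; auto. rewrite Hm, S3. auto.
        -- rewrite HV, S5, in_app_iff; tauto.
        -- rewrite HV, S5, in_app_iff; tauto.
        -- rewrite HE, S6, in_app_iff; tauto.
        -- rewrite HE, S6, in_app_iff; tauto.
  - left. apply HV in Hx as [Hx|Hx].
    + destruct (ttsp_from _ (TTSP_wf _ T2) (gt G2)) as [r2 R2]; auto.
      exists r2. rewrite Hs, Ht, Hs12, Ht12. split; [eauto using path_incl|].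
      intros Hin. destruct (Hint x Hx); try congruence.
      eapply TTSP_path_vertices; eauto.
    + destruct (ttsp_from _ (TTSP_wf _ T1) (gt G1)) as [r2 R2]; auto.
      exists r2. rewrite Hs, Ht. split; [eauto using path_incl|].
      intros Hin. destruct (Hint x); try congruence.
      eapply TTSP_path_vertices; eauto.
Qed.

Lemma TTSP_add_ear_whole G q :
  TTSP G -> ear (gV G) (gE G) (gs G) q (gt G) -> TTSP (add_ear G (gs G) q).
Proof.
  intros T He.
  apply (TTSP_parallel G (ear_graph (gs G) q (gt G))); simpl; auto.
  - destruct He. eapply TTSP_path; eauto.
  - intros v Hv Hq. apply (ear_inner _ _ _ _ _ He); auto.
  - intros e H1 H2. exact (ear_edges _ _ _ _ _ He e H2 H1).
  - intros v. rewrite in_app_iff; simpl; tauto.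
  - intros e. rewrite in_app_iff; simpl; tauto.
Qed.

Lemma add_ear_series_r G1 G2 G x q y :
  TTSP G1 -> is_series G1 G2 G -> In x (gV G2) -> In y (gV G2) ->
  ear (gV G) (gE G) x q y -> TTSP (add_ear G2 x q) -> TTSP (add_ear G x q).
Proof.
  intros T1 (S1 & S2 & S3 & S4 & S5 & S6) Hx Hy He T.
  apply (TTSP_series G1 (add_ear G2 x q)); simpl; auto.
  - intros v Hv Hv'. apply in_app_iff in Hv' as [Hv'|Hv']; auto.
    apply S2; auto. destruct (ear_inner _ _ _ _ _ He v Hv') as [->| ->]; auto.
    apply S5; auto.
  - intros v. rewrite !in_app_iff, S5; tauto.
  - intros v. rewrite !in_app_iff, S6; tauto.
Qed.

Lemma add_ear_series_l G1 G2 G x q y :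
  TTSP G2 -> is_series G1 G2 G -> In x (gV G1) -> In y (gV G1) ->
  ear (gV G) (gE G) x q y -> TTSP (add_ear G1 x q) -> TTSP (add_ear G x q).
Proof.
  intros T1 (S1 & S2 & S3 & S4 & S5 & S6) Hx Hy He T.
  apply (TTSP_series (add_ear G1 x q) G2); simpl; auto.
  - intros v Hv Hv'. apply in_app_iff in Hv as [Hv|Hv]; auto.
    apply S2; auto. destruct (ear_inner _ _ _ _ _ He v Hv) as [->| ->]; auto.
    apply S5; auto.
  - intros v. rewrite !in_app_iff, S5; tauto.
  - intros v. rewrite !in_app_iff, S6; tauto.
Qed.

(** * Ears across the junction of a series composition *)

Section SeriesEar.
Variables (G1 G2 G : graph) (x : nat) (q : list nat) (y : nat).
Hypotheses (T1 : TTSP G1) (T2 : TTSP G2) (HS : is_series G1 G2 G).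
Hypotheses (Hx : In x (gV G1)) (Nx : x <> gt G1) (Hy : In y (gV G2)) (Ny : y <> gs G2).
Hypothesis He : ear (gV G) (gE G) x q y.

Lemma series_ear_incl :
  incl (gE G1) (gE (add_ear G x q)) /\ incl (gE G2) (gE (add_ear G x q)) /\
  incl (walk_edges (x :: q)) (gE (add_ear G x q)) /\ incl (gV G1) (gV G) /\ incl (gV G2) (gV G).
Proof.
  destruct HS as (S1 & S2 & S3 & S4 & S5 & S6).
  repeat split; intros e H; cbn [add_ear gE]; rewrite ?in_app_iff, ?S5, ?S6; tauto.
Qed.

Lemma series_ear_disj : ~ In x (gV G2) /\ ~ In y (gV G1).
Proof.
  destruct HS as (S1 & S2 & S3 & S4 & S5 & S6). split; intros H.
  - apply Nx; auto.
  - apply Ny. rewrite <- S1; auto.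
Qed.

Lemma ear_tail_notin : ~ In x q.
Proof. pose proof (ear_NoDup _ _ _ _ _ He) as H. now inversion H. Qed.

(** Let [a] be the last vertex on [r] of a path from the source to [x]. Two paths lead from [a] to
    [y]: one through [x] and the ear, the other along [r] and through the junction. A path from [x]
    to the junction inside [G1] bridges them. *)
Lemma wheatstone_avoid_source_end r :
  path (gE G1) (gs G1) r (gt G1) -> ~ In x (gs G1 :: r) ->
  wheatstone (gE (add_ear G x q)).
Proof.
  intros R Nr. pose proof HS as (S1 & S2 & S3 & S4 & S5 & S6).
  destruct series_ear_incl as (I1 & I2 & Iq & J1 & J2), series_ear_disj as [Dx Dy].
  pose proof (TTSP_wf _ T1) as F1; pose proof (TTSP_wf _ T2) as F2.
  destruct (ttsp_from _ F1 x Hx) as [r0 A].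
  destruct (ttsp_to _ F1 x Hx) as [b B].
  destruct (ttsp_from _ F2 y Hy) as [c C].
  destruct (last_hit _ (fun v => In v (gs G1 :: r))
              (fun v => in_dec Nat.eq_dec v (gs G1 :: r)) _ _ _ A) as
    (a & a1 & a2 & -> & A1 & A2 & Da & Ha); [now left|].
  destruct (path_split _ _ _ _ _ R Da) as (r1 & r2 & -> & R1 & R2).
  assert (Va : In a (gV G1)) by (eapply TTSP_path_vertices; [exact T1|exact A1|auto|eapply path_end_in; eauto]).
  assert (Nax : a <> x) by (intros ->; auto).
  assert (Nam : a <> gt G1).
  { intros ->. destruct a2 as [|w a2]; [apply path_nil_eq in A2; auto|].
    apply path_cons_inv in A2 as [A2 _]. exact (ttsp_snk _ F1 _ A2). }
  assert (Vr : forall z, In z r2 -> In z (gV G1)).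
  { intros z Hz. eapply TTSP_path_vertices; [exact T1|exact R2|exact Va|now right]. }
  assert (Vc : forall z, In z c -> In z (gV G2)).
  { intros z Hz. eapply TTSP_path_vertices; [exact T2|exact C|auto|now right]. }
  exists a, y, (a2 ++ q), (r2 ++ c), x, (gt G1), b. repeat split.
  - apply (path_app _ _ _ x); [eauto using path_incl|].
    eapply path_incl; [exact Iq|apply (ear_path _ _ _ _ _ He)].
  - apply (path_app _ _ _ (gt G1)); [eauto using path_incl|].
    rewrite S1; eauto using path_incl.
  - assert (K : forall z, In z q -> In z (gV G) -> z = y).
    { intros z Hz HV. destruct (ear_inner _ _ _ _ _ He z) as [->| ->]; auto; [now right|].
      now destruct ear_tail_notin. }
    intros z Hz1 Hz2. apply in_app_iff in Hz1 as [Hz1|Hz1]; apply in_app_iff in Hz2 as [Hz2|Hz2]; auto.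
    + destruct (Ha z Hz1). right. apply in_app_iff; auto.
    + assert (z = gt G1) as ->.
      { apply S2; auto. eapply TTSP_path_vertices; [exact T1|exact A2|exact Va|now right]. }
      destruct (Ha _ Hz1). exact (path_end_in _ _ _ _ R).
  - apply in_app_iff; left. now apply (path_end_tail _ _ _ _ A2).
  - congruence.
  - apply in_app_iff; left. now apply (path_end_tail _ _ _ _ R2).
  - congruence.
  - eauto using path_incl.
Qed.

(** The mirror image. The two paths lead from [x] to the first vertex [t] on [r] of a path from [y]
    to the sink: one through the junction and along [r], the other through the ear and [y]. A path
    from the junction to [y] inside [G2] bridges them. *)
Lemma wheatstone_avoid_sink_end r :
  path (gE G2) (gs G2) r (gt G2) -> ~ In y (gs G2 :: r) ->
  wheatstone (gE (add_ear G x q)).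
Proof.
  intros R Nr. pose proof HS as (S1 & S2 & S3 & S4 & S5 & S6).
  destruct series_ear_incl as (I1 & I2 & Iq & J1 & J2), series_ear_disj as [Dx Dy].
  pose proof (TTSP_wf _ T1) as F1; pose proof (TTSP_wf _ T2) as F2.
  destruct (ttsp_to _ F2 y Hy) as [r0 A].
  destruct (ttsp_from _ F2 y Hy) as [c C].
  destruct (ttsp_to _ F1 x Hx) as [b B].
  destruct (first_hit _ (fun v => In v (gs G2 :: r))
              (fun v => in_dec Nat.eq_dec v (gs G2 :: r)) _ _ _ A) as
    (t & a1 & a2 & -> & A1 & A2 & Dt & Ha & _); [exact (path_end_in _ _ _ _ R)|].
  destruct (path_split _ _ _ _ _ R Dt) as (r1 & r2 & -> & R1 & R2).
  assert (Nty : t <> y) by (intros ->; auto).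
  assert (Ha1 : forall z, In z a1 -> In z (gV G2)).
  { intros z Hz. eapply TTSP_path_vertices; [exact T2|exact A1|auto|now right]. }
  assert (Hma : ~ In (gs G2) a1).
  { intros Hm. destruct (path_in_edge _ _ _ _ _ A1 Hm) as [w Hw]. exact (ttsp_src _ F2 _ Hw). }
  assert (Nmt : gs G2 <> t).
  { intros <-. apply Hma. apply (path_end_tail _ _ _ _ A1); auto. }
  assert (Vb : forall z, In z b -> In z (gV G1)).
  { intros z Hz. eapply TTSP_path_vertices; [exact T1|exact B|auto|now right]. }
  assert (Vr : forall z, In z r1 -> In z (gV G2)).
  { intros z Hz. eapply TTSP_path_vertices; [exact T2|exact R1|auto|now right]. }
  exists x, t, (b ++ r1), (q ++ a1), (gs G2), y, c. repeat split.
  - apply (path_app _ _ _ (gs G2)); [rewrite <- S1|]; eauto using path_incl.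
  - apply (path_app _ _ _ y); [|eauto using path_incl].
    eapply path_incl; [exact Iq|apply (ear_path _ _ _ _ _ He)].
  - assert (K : forall z, In z q -> In z (gV G) -> z = y).
    { intros z Hz HV. destruct (ear_inner _ _ _ _ _ He z) as [->| ->]; auto; [now right|].
      now destruct ear_tail_notin. }
    intros z Hz1 Hz2. apply in_app_iff in Hz1 as [Hz1|Hz1]; apply in_app_iff in Hz2 as [Hz2|Hz2]; auto.
    + rewrite (K z) in Hz1; auto. now destruct Dy; auto.
    + destruct Hma. rewrite <- S1, <- (S2 z); auto.
    + rewrite (K z) in Hz1; auto. destruct Nr. right. apply in_app_iff; auto.
    + apply Ha; [now right|]. right. apply in_app_iff; auto.
  - apply in_app_iff; left. rewrite <- S1. now apply (path_end_tail _ _ _ _ B).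
  - auto.
  - apply in_app_iff; left. apply (path_end_tail _ _ _ _ (ear_path _ _ _ _ _ He)).
    exact (ear_neq _ _ _ _ _ He).
  - auto.
  - eauto using path_incl.
Qed.

End SeriesEar.

(** If [y] splits [G2] into [Ga] and [Gb], the ear is parallel to the series composition of [G1] and
    [Ga], and [Gb] follows in series. If [y] is the sink, the ear is parallel to the whole graph.
    Otherwise a path through [G2] avoids [y]. *)
Lemma ear_from_source G1 G2 G q y :
  TTSP G1 -> TTSP G2 -> is_series G1 G2 G -> In y (gV G2) -> y <> gs G2 ->
  ear (gV G) (gE G) (gs G) q y ->
  TTSP (add_ear G (gs G) q) \/ wheatstone (gE (add_ear G (gs G) q)).
Proof.
  intros T1 T2 HS Hy Ny He.
  pose proof HS as (S1 & S2 & S3 & S4 & S5 & S6).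
  pose proof (TTSP_is_series _ _ _ T1 T2 HS) as T.
  destruct (Nat.eq_dec y (gt G2)) as [->|Nt].
  { left. apply TTSP_add_ear_whole; auto. now rewrite S4. }
  destruct (TTSP_cut_vertex _ T2 y Hy Ny Nt) as
    [(r & R & Nr)|(Ga & Gb & Ta & Tb & (R1 & R2 & R3 & R4 & R5 & R6) & Ey)].
  { right. rewrite S3 in *. apply (wheatstone_avoid_sink_end G1 G2 G (gs G1) q y) with r; auto. }
  left.
  assert (Tj : TTSP (graph_join G1 Ga)).
  { apply (TTSP_series G1 Ga); simpl; auto using in_app_iff; try congruence.
    intros v Hv Hv2. apply S2; auto. apply R5; auto. }
  assert (HE : incl (gV (graph_join G1 Ga)) (gV G) /\ incl (gE (graph_join G1 Ga)) (gE G)).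
  { split; intros v Hv; simpl in Hv; apply in_app_iff in Hv;
    [rewrite S5, R5|rewrite S6, R6]; tauto. }
  apply (add_ear_series_l (graph_join G1 Ga) Gb G (gs G) q y); auto.
  - repeat split; simpl; auto; try congruence.
    + intros v Hv Hv'. apply in_app_iff in Hv as [Hv|Hv]; auto.
      assert (v = gt G1) as -> by (apply S2; auto; apply R5; auto).
      apply R2; auto. rewrite S1, R3. auto.
    + rewrite S5, R5, in_app_iff; tauto.
    + rewrite S5, R5, in_app_iff; tauto.
    + rewrite S6, R6, in_app_iff; tauto.
    + rewrite S6, R6, in_app_iff; tauto.
  - simpl. rewrite S3. apply in_app_iff; left; auto.
  - simpl. rewrite <- Ey. apply in_app_iff; right; auto.
  - rewrite S3. change (gs G1) with (gs (graph_join G1 Ga)). apply TTSP_add_ear_whole; auto.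
    simpl. rewrite Ey, <- S3. eapply ear_incl; [| |exact He]; tauto.
Qed.

(** If [x] splits [G1] into [Ga] and [Gb], the ear starts at the source of the composition of [Gb]
    and [G2]; this reduces the claim to [ear_from_source], with [Ga] put in front afterwards. *)
Lemma ear_series G1 G2 G x q y :
  TTSP G1 -> TTSP G2 -> is_series G1 G2 G ->
  In x (gV G1) -> x <> gt G1 -> In y (gV G2) -> y <> gs G2 ->
  ear (gV G) (gE G) x q y ->
  TTSP (add_ear G x q) \/ wheatstone (gE (add_ear G x q)).
Proof.
  intros T1 T2 HS Hx Nx Hy Ny He.
  pose proof HS as (S1 & S2 & S3 & S4 & S5 & S6).
  destruct (Nat.eq_dec x (gs G1)) as [->|Ns].
  { rewrite <- S3 in *. apply (ear_from_source G1 G2 G q y); auto. }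
  destruct (TTSP_cut_vertex _ T1 x Hx Ns Nx) as
    [(r & R & Nr)|(Ga & Gb & Ta & Tb & (R1 & R2 & R3 & R4 & R5 & R6) & Ex)].
  { right. apply (wheatstone_avoid_source_end G1 G2 G x q y) with r; auto. }
  assert (HJ : is_series Gb G2 (graph_join Gb G2)).
  { repeat split; simpl; auto; try congruence; try (apply in_app_iff).
    intros v Hv Hv2. rewrite <- R4. apply S2; auto. apply R5; auto. }
  pose proof (TTSP_is_series _ _ _ Tb T2 HJ) as Tj.
  assert (HE : incl (gV (graph_join Gb G2)) (gV G) /\ incl (gE (graph_join Gb G2)) (gE G)).
  { split; intros v Hv; simpl in Hv; apply in_app_iff in Hv;
    [rewrite S5, R5|rewrite S6, R6]; tauto. }
  assert (Exb : x = gs (graph_join Gb G2)) by (simpl; congruence).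
  destruct (ear_from_source Gb G2 (graph_join Gb G2) q y Tb T2 HJ Hy Ny) as [TW|W].
  { rewrite <- Exb. eapply ear_incl; [| |exact He]; tauto. }
  - left. rewrite <- Exb in TW.
    apply (add_ear_series_r Ga (graph_join Gb G2) G x q y); auto.
    + repeat split; simpl; auto; try congruence.
      * intros v Hv Hv'. apply in_app_iff in Hv' as [Hv'|Hv']; auto.
        assert (v = gt G1) as -> by (apply S2; auto; apply R5; auto).
        apply R2; auto. rewrite R4. auto.
      * rewrite S5, R5, in_app_iff; tauto.
      * rewrite S5, R5, in_app_iff; tauto.
      * rewrite S6, R6, in_app_iff; tauto.
      * rewrite S6, R6, in_app_iff; tauto.
    + simpl. rewrite <- Ex, R1. apply in_app_iff; left; auto.
    + simpl. apply in_app_iff; right; auto.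
  - right. eapply wheatstone_incl; [|exact W]. rewrite <- Exb.
    intros e H. apply in_app_iff in H as [H|H]; apply in_app_iff; [left; now apply HE|now right].
Qed.

Lemma wheatstone_parallel E G1 G2 x q y :
  TTSP G1 -> TTSP G2 -> gs G1 = gs G2 -> gt G1 = gt G2 ->
  (forall v, In v (gV G1) -> In v (gV G2) -> v = gs G1 \/ v = gt G1) ->
  In x (gV G1) -> ~ In x (gV G2) -> In y (gV G2) -> ~ In y (gV G1) ->
  incl (gE G1) E -> incl (gE G2) E -> path E x q y -> wheatstone E.
Proof.
  intros T1 T2 Hs Ht Hint Hx Nx Hy Ny I1 I2 Q.
  pose proof (TTSP_wf _ T1) as F1; pose proof (TTSP_wf _ T2) as F2.
  destruct (ttsp_from _ F1 x Hx) as [a A]. destruct (ttsp_to _ F1 x Hx) as [a' A'].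
  destruct (ttsp_from _ F2 y Hy) as [b B]. destruct (ttsp_to _ F2 y Hy) as [b' B'].
  pose proof (path_app _ _ _ _ _ _ A A') as AA. pose proof (path_app _ _ _ _ _ _ B B') as BB.
  exists (gs G1), (gt G1), (a ++ a'), (b ++ b'), x, y, q. repeat split.
  - eauto using path_incl.
  - rewrite Hs, Ht. eauto using path_incl.
  - intros z Hz1 Hz2.
    destruct (Hint z); auto.
    + eapply TTSP_path_vertices; [exact T1|exact AA|auto|now right].
    + eapply TTSP_path_vertices; [exact T2|exact BB|auto|now right].
    + subst z. destruct (path_in_edge _ _ _ _ _ AA Hz1) as [w Hw].
      destruct (ttsp_src _ F1 _ Hw).
  - apply in_app_iff; left. apply (path_end_tail _ _ _ _ A). intros <-. apply Nx. rewrite Hs; auto.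
  - intros ->. apply Nx. rewrite Ht; auto.
  - apply in_app_iff; left. apply (path_end_tail _ _ _ _ B). intros <-. apply Ny. rewrite <- Hs; auto.
  - intros ->. apply Ny. auto.
  - eauto using path_incl.
Qed.

(** The last hypothesis excludes ears from the sink to the source of a single edge and from the
    second factor of a series composition back to the first. In a parallel composition, an ear with
    both ends in one factor is handled by induction; any other ear joins inner vertices of different
    factors and is itself the bridge. *)
Lemma TTSP_ear G : TTSP G -> forall x q y,
  In x (gV G) -> In y (gV G) -> ear (gV G) (gE G) x q y ->
  (forall r, ~ path (gE G) y r x) ->
  TTSP (add_ear G x q) \/ wheatstone (gE (add_ear G x q)).
Proof.
  induction 1 as [G Hst HV HE
    |G1 G2 G T1 IH1 T2 IH2 Hm Hint Hs Ht HV HE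
    |G1 G2 G T1 IH1 T2 IH2 Hs12 Ht12 Hint Hdis Hs Ht HV HE]; intros x q y Hx Hy He Hr.
  - left. pose proof (ear_neq _ _ _ _ _ He) as N.
    assert (P : path (gE G) (gs G) [gt G] (gt G)) by (apply path_one; now apply HE).
    apply HV in Hx as [->| ->]; apply HV in Hy as [->| ->]; try easy.
    + apply TTSP_add_ear_whole; auto. now apply TTSP_edge.
    + destruct (Hr _ P).
  - assert (I1 : incl (gE G1) (gE G)) by eauto.
    assert (I2 : incl (gE G2) (gE G)) by eauto.
    assert (J1 : incl (gV G1) (gV G)) by eauto.
    assert (J2 : incl (gV G2) (gV G)) by eauto.
    assert (HS : is_series G1 G2 G) by (repeat split; auto; intros; try apply HV; try apply HE; auto).
    assert (C1 : In x (gV G1) -> In y (gV G1) ->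
              TTSP (add_ear G x q) \/ wheatstone (gE (add_ear G x q))).
    { intros Hx1 Hy1. destruct (IH1 x q y Hx1 Hy1) as [T|W].
      - eapply ear_incl; eauto.
      - intros r Hp. apply (Hr r). eauto using path_incl.
      - left. apply (add_ear_series_l G1 G2 G x q y); auto.
      - right. eapply wheatstone_incl; [|exact W]. apply incl_app_app; auto using incl_refl. }
    assert (C2 : In x (gV G2) -> In y (gV G2) ->
              TTSP (add_ear G x q) \/ wheatstone (gE (add_ear G x q))).
    { intros Hx1 Hy1. destruct (IH2 x q y Hx1 Hy1) as [T|W].
      - eapply ear_incl; eauto.
      - intros r Hp. apply (Hr r). eauto using path_incl.
      - left. apply (add_ear_series_r G1 G2 G x q y); auto.
      - right. eapply wheatstone_incl; [|exact W]. apply incl_app_app; auto using incl_refl. }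
    destruct (proj1 (HV x) Hx) as [Hx1|Hx2]; destruct (proj1 (HV y) Hy) as [Hy1|Hy2]; auto.
    + destruct (Nat.eq_dec x (gt G1)) as [->|Nx]; [apply C2; auto; rewrite Hm; auto|].
      destruct (Nat.eq_dec y (gs G2)) as [->|Ny]; [apply C1; auto; rewrite <- Hm; auto|].
      apply (ear_series G1 G2 G x q y); auto.
    + exfalso.
      destruct (ttsp_to _ (TTSP_wf _ T1) y Hy1) as [b B].
      destruct (ttsp_from _ (TTSP_wf _ T2) x Hx2) as [a A].
      apply (Hr (b ++ a)). apply (path_app _ _ _ (gs G2)); [rewrite <- Hm|]; eauto using path_incl.
  - assert (I1 : incl (gE G1) (gE G)) by eauto.
    assert (I2 : incl (gE G2) (gE G)) by eauto.
    assert (J1 : incl (gV G1) (gV G)) by eauto.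
    assert (J2 : incl (gV G2) (gV G)) by eauto.
    assert (C1 : In x (gV G1) -> In y (gV G1) ->
              TTSP (add_ear G x q) \/ wheatstone (gE (add_ear G x q))).
    { intros Hx1 Hy1. destruct (IH1 x q y Hx1 Hy1) as [T|W].
      - eapply ear_incl; eauto.
      - intros r Hp. apply (Hr r). eauto using path_incl.
      - left. apply (TTSP_parallel (add_ear G1 x q) G2); auto.
        + intros v Hv Hv2. cbn [add_ear gV] in Hv. apply in_app_iff in Hv as [Hv|Hv]; [now apply Hint|].
          apply Hint; auto. destruct (ear_inner _ _ _ _ _ He v Hv) as [->| ->]; auto.
        + intros e H1 H2. apply in_app_iff in H1 as [H1|H1]; [eapply Hdis; eauto|].
          exact (ear_edges _ _ _ _ _ He e H1 (I2 _ H2)).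
        + intros v. cbn [add_ear gV]. rewrite !in_app_iff, HV. tauto.
        + intros v. cbn [add_ear gE]. rewrite !in_app_iff, HE. tauto.
      - right. eapply wheatstone_incl; [|exact W]. apply incl_app_app; auto using incl_refl. }
    assert (C2 : In x (gV G2) -> In y (gV G2) ->
              TTSP (add_ear G x q) \/ wheatstone (gE (add_ear G x q))).
    { intros Hx1 Hy1. destruct (IH2 x q y Hx1 Hy1) as [T|W].
      - eapply ear_incl; eauto.
      - intros r Hp. apply (Hr r). eauto using path_incl.
      - left. apply (TTSP_parallel G1 (add_ear G2 x q)); auto.
        + intros v Hv2 Hv. cbn [add_ear gV] in Hv. apply in_app_iff in Hv as [Hv|Hv]; [now apply Hint|].
          apply Hint; auto. destruct (ear_inner _ _ _ _ _ He v Hv) as [->| ->]; auto.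
        + intros e H2 H1. apply in_app_iff in H1 as [H1|H1]; [eapply Hdis; eauto|].
          exact (ear_edges _ _ _ _ _ He e H1 (I1 _ H2)).
        + intros v. cbn [add_ear gV]. rewrite !in_app_iff, HV. tauto.
        + intros v. cbn [add_ear gE]. rewrite !in_app_iff, HE. tauto.
      - right. eapply wheatstone_incl; [|exact W]. apply incl_app_app; auto using incl_refl. }
    assert (K1 : incl (gE G1) (gE (add_ear G x q))) by (apply incl_appl; auto).
    assert (K2 : incl (gE G2) (gE (add_ear G x q))) by (apply incl_appl; auto).
    assert (Kq : path (gE (add_ear G x q)) x q y).
    { eapply path_incl; [|exact (ear_path _ _ _ _ _ He)]. apply incl_appr, incl_refl. }
    destruct (in_dec Nat.eq_dec x (gV G1)) as [Hx1|Hx1];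
    destruct (in_dec Nat.eq_dec x (gV G2)) as [Hx2|Hx2];
    destruct (in_dec Nat.eq_dec y (gV G1)) as [Hy1|Hy1];
    destruct (in_dec Nat.eq_dec y (gV G2)) as [Hy2|Hy2]; auto;
    try (exfalso; apply HV in Hx; apply HV in Hy; tauto); right.
    + apply (wheatstone_parallel _ G1 G2 x q y); auto.
    + apply (wheatstone_parallel _ G2 G1 x q y); auto.
      intros v Hv2 Hv1. rewrite <- Hs12, <- Ht12. auto.
Qed.

(** * Ear decomposition of an acyclic [st]-graph *)

Definition edge_eq_dec (e e' : nat * nat) : {e = e'} + {e <> e'}.
Proof. decide equality; apply Nat.eq_dec. Defined.

Definition missing (E F : list (nat * nat)) : list (nat * nat) :=
  filter (fun e => if in_dec edge_eq_dec e F then false else true) E.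

Lemma missing_in E F e : In e (missing E F) <-> In e E /\ ~ In e F.
Proof.
  unfold missing. rewrite filter_In. destruct (in_dec edge_eq_dec e F); intuition congruence.
Qed.

Lemma missing_lt E F F' e : incl F F' -> In e E -> ~ In e F -> In e F' ->
  (length (missing E F') < length (missing E F))%nat.
Proof.
  intros I. induction E as [|d E IH]; [easy|]; intros He N Y.
  assert (L : forall D, (length (missing D F') <= length (missing D F))%nat).
  { clear IH He. induction D as [|c D IH]; [reflexivity|]; unfold missing in *; simpl.
    destruct (in_dec edge_eq_dec c F'), (in_dec edge_eq_dec c F); simpl; try lia.
    exfalso; auto. }
  specialize (L E). unfold missing in *; simpl.
  destruct He as [->|He].
  - destruct (in_dec edge_eq_dec e F'), (in_dec edge_eq_dec e F); simpl; try easy; lia.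
  - specialize (IH He N Y).
    destruct (in_dec edge_eq_dec d F'), (in_dec edge_eq_dec d F); simpl; try lia.
    exfalso; auto.
Qed.

Section Growth.
Variable G : graph.
Hypotheses (HG : st_graph G) (Hac : no_cycle (gE G)).

Lemma st_graph_from v : In v (gV G) -> exists q, path (gE G) (gs G) q v.
Proof.
  intros Hv. destruct HG as (_ & _ & _ & _ & _ & _ & _ & _ & HW).
  destruct (HW v Hv) as (p & Hp & Hin). apply st_walk_path in Hp as (q & -> & Q).
  destruct (path_split _ _ _ _ _ Q Hin) as (q1 & q2 & _ & Q1 & _). eauto.
Qed.

Lemma st_graph_to v : In v (gV G) -> exists q, path (gE G) v q (gt G).
Proof.
  intros Hv. destruct HG as (_ & _ & _ & _ & _ & _ & _ & _ & HW).
  destruct (HW v Hv) as (p & Hp & Hin). apply st_walk_path in Hp as (q & -> & Q).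
  destruct (path_split _ _ _ _ _ Q Hin) as (q1 & q2 & _ & _ & Q2). eauto.
Qed.

Lemma st_graph_ends u v : In (u, v) (gE G) -> In u (gV G) /\ In v (gV G).
Proof. destruct HG as (_ & _ & _ & _ & _ & HE & _). intros H; destruct (HE _ _ H); tauto. Qed.

(** The edge lies on a walk from source to sink. The ear is the part of this walk between the last
    vertex of [H] before the edge and the first vertex of [H] after it; its ends differ, as
    otherwise it would be a cycle. *)
Lemma st_graph_ear H a b : TTSP H -> gs H = gs G -> gt H = gt G -> incl (gE H) (gE G) ->
  In (a, b) (gE G) -> ~ In (a, b) (gE H) ->
  exists x q y, In x (gV H) /\ In y (gV H) /\ path (gE G) x q y /\
    ear (gV H) (gE H) x q y /\ In (a, b) (walk_edges (x :: q)).
Proof.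
  intros T Hs Ht IE Hab Nab. pose proof (TTSP_wf _ T) as F.
  destruct (st_graph_ends _ _ Hab) as [Va Vb].
  destruct (st_graph_from a Va) as [p1 P1]. destruct (st_graph_to b Vb) as [p2 P2].
  set (D v := In v (gV H)).
  assert (Ddec : forall v, {D v} + {~ D v}) by (intros v; apply in_dec, Nat.eq_dec).
  destruct (last_hit _ D Ddec _ _ _ P1) as (x & r1 & q1 & -> & _ & Q1 & Dx & Hq1).
  { rewrite <- Hs. apply ttsp_s, F. }
  destruct (first_hit _ D Ddec _ _ _ P2) as (y & q2 & r2 & -> & Q2 & _ & Dy & Hq2 & Hq2').
  { rewrite <- Ht. apply ttsp_t, F. }
  assert (Q : path (gE G) x (q1 ++ b :: q2) y) by (eapply path_app; eauto).
  exists x, (q1 ++ b :: q2), y.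
  rewrite (walk_edges_app _ _ _ a (b :: q2) Q1).
  change (walk_edges (a :: b :: q2)) with ((a, b) :: walk_edges (b :: q2)).
  repeat split; auto.
  - eapply path_self; eauto.
  - eapply no_cycle_NoDup; eauto.
  - intros ->. apply Hac in Q. now destruct q1.
  - intros v [<-|Hv] HV; auto. apply in_app_iff in Hv as [Hv|Hv]; [destruct (Hq1 v Hv HV)|].
    right. apply Hq2; auto.
  - rewrite (walk_edges_app _ _ _ a (b :: q2) Q1).
    intros [c d] He HcdH. apply in_app_iff in He as [He|[He|He]].
    + apply walk_edges_vertices in He as [_ He]. apply (Hq1 d He). eapply ttsp_cod; eauto.
    + congruence.
    + apply (Hq2' _ He). eapply ttsp_dom; eauto.
  - apply in_app_iff; right; now left.
Qed.

Lemma TTSP_grow n H : TTSP H -> gs H = gs G -> gt H = gt G ->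
  incl (gV H) (gV G) -> incl (gE H) (gE G) -> (length (missing (gE G) (gE H)) <= n)%nat ->
  TTSP G \/ wheatstone (gE G).
Proof.
  revert H; induction n as [|n IH]; intros H T Hs Ht IV IE Hn.
  all: destruct (missing (gE G) (gE H)) as [|[a b] l] eqn:El.
  (* No edge is missing. Then no vertex is missing either, since a path from the source to it runs
     entirely in [H]. *)
  1,3: left; apply (TTSP_ext H); auto;
    assert (IE' : incl (gE G) (gE H)) by
      (intros e He; destruct (in_dec edge_eq_dec e (gE H)) as [Y|N]; [exact Y|];
       assert (Hm : In e (missing (gE G) (gE H))) by (apply missing_in; auto);
       rewrite El in Hm; destruct Hm);
    split; auto; intros Hv;
    destruct (st_graph_from v Hv) as [q Q];
    apply (TTSP_path_vertices H (gs G) v q); auto;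
    [eauto using path_incl|rewrite <- Hs; apply ttsp_s; auto|eauto using path_end_in].
  { simpl in Hn; lia. }
  assert (Hab : In (a, b) (gE G) /\ ~ In (a, b) (gE H)).
  { apply missing_in. rewrite El. now left. }
  destruct Hab as [Hab Nab].
  destruct (st_graph_ear H a b) as (x & q & y & Hx & Hy & Q & He & Hin); auto.
  assert (Iq : incl (walk_edges (x :: q)) (gE G)) by (intros e; eapply path_edges; eauto).
  destruct (TTSP_ear H T x q y Hx Hy He) as [T'|W].
  (* A path back from [y] to [x] would close a cycle with the ear. *)
  - intros r R. apply (ear_neq _ _ _ _ _ He).
    eapply no_cycle_antisym; eauto using path_incl.
  - apply (IH (add_ear H x q)); auto.
    + apply incl_app; auto. intros v [<-|Hv]; auto.
      destruct (path_in_edge _ _ _ _ _ Q Hv) as [u Hu]. now apply st_graph_ends in Hu.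
    + apply incl_app; auto.
    + assert ((length (missing (gE G) (gE (add_ear H x q))) < length (missing (gE G) (gE H)))%nat).
      { apply (missing_lt _ _ _ (a, b)); auto.
        - apply incl_appl, incl_refl.
        - apply in_app_iff; auto. }
      rewrite El in *. simpl in *. lia.
  - right. eapply wheatstone_incl; [|exact W]. apply incl_app; auto.
Qed.

Theorem TTSP_or_wheatstone : TTSP G \/ wheatstone (gE G).
Proof.
  pose proof HG as (_ & _ & Vs & Vt & Nst & _).
  destruct (st_graph_to _ Vs) as [q Q].
  assert (I : incl (walk_edges (gs G :: q)) (gE G)) by (intros e; eapply path_edges; eauto).
  eapply (TTSP_grow _ (ear_graph (gs G) q (gt G))); simpl; auto.
  - eapply TTSP_path; eauto using no_cycle_NoDup.
  - intros v [<-|Hv]; auto.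
    destruct (path_in_edge _ _ _ _ _ Q Hv) as [u Hu]. now apply st_graph_ends in Hu.
Qed.

End Growth.

(** * Finite sums *)

Lemma sumR_cons {A} (f : A -> R) a l : sumR f (a :: l) = f a + sumR f l.
Proof. reflexivity. Qed.

Lemma sumR_app {A} (f : A -> R) l l' : sumR f (l ++ l') = sumR f l + sumR f l'.
Proof. induction l as [|a l IH]; simpl; [lra|rewrite IH; lra]. Qed.

Lemma sumR_ext {A} (f g : A -> R) l : (forall a, In a l -> f a = g a) -> sumR f l = sumR g l.
Proof.
  induction l as [|a l IH]; intros H; simpl; [reflexivity|].
  rewrite IH, (H a); auto with datatypes.
Qed.

Lemma sumR_zero {A} (f : A -> R) l : (forall a, In a l -> f a = 0) -> sumR f l = 0.
Proof.
  induction l as [|a l IH]; intros H; simpl; [reflexivity|].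
  rewrite IH, (H a); auto with datatypes; lra.
Qed.

Lemma sumR_le {A} (f g : A -> R) l : (forall a, In a l -> f a <= g a) -> sumR f l <= sumR g l.
Proof.
  induction l as [|a l IH]; intros H; simpl; [lra|].
  apply Rplus_le_compat; auto with datatypes.
Qed.

Lemma sumR_nonneg {A} (f : A -> R) l : (forall a, In a l -> 0 <= f a) -> 0 <= sumR f l.
Proof. intros H. rewrite <- (sumR_zero (fun _ => 0) l) by auto. now apply sumR_le. Qed.

Lemma sumR_plus {A} (f g : A -> R) l : sumR (fun a => f a + g a) l = sumR f l + sumR g l.
Proof. induction l as [|a l IH]; simpl; [lra|rewrite IH; lra]. Qed.

Lemma sumR_scal {A} c (f : A -> R) l : sumR (fun a => c * f a) l = c * sumR f l.
Proof. induction l as [|a l IH]; simpl; [lra|rewrite IH; lra]. Qed.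

Lemma sumR_exchange {A B} (f : A -> B -> R) l l' :
  sumR (fun a => sumR (f a) l') l = sumR (fun b => sumR (fun a => f a b) l) l'.
Proof.
  induction l as [|a l IH]; simpl.
  - symmetry; now apply sumR_zero.
  - now rewrite IH, <- sumR_plus.
Qed.

Lemma sumR_perm {A} (f : A -> R) l l' : Permutation l l' -> sumR f l = sumR f l'.
Proof. induction 1; simpl; lra. Qed.

Lemma sumR_pos {A} (f : A -> R) l :
  (forall a, 0 <= f a) -> 0 < sumR f l -> exists a, In a l /\ 0 < f a.
Proof.
  intros Hf. induction l as [|a l IH]; simpl; intros H; [lra|].
  destruct (Rle_lt_or_eq_dec _ _ (Hf a)) as [Ha|Ha]; [eauto|].
  destruct IH as (b & Hb & Fb); [lra|eauto].
Qed.

Lemma sumN_INR {A} (f : A -> nat) l : INR (sumN f l) = sumR (fun a => INR (f a)) l.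
Proof. induction l as [|a l IH]; simpl; [reflexivity|now rewrite plus_INR, IH]. Qed.

(** * Flows on TTSP graphs *)

(* [proj] is [fst] for the flow out of [v] and [snd] for the flow into [v];
   [nodup] because the edge list of a TTSP graph may have repetitions. *)
Definition flux (proj : nat * nat -> nat) (E : list (nat * nat)) (f : nat * nat -> R) (v : nat) : R :=
  sumR f (filter (fun e => Nat.eqb (proj e) v) (nodup edge_eq_dec E)).

Lemma flux_NoDup proj E f v : NoDup E ->
  flux proj E f v = sumR f (filter (fun e => Nat.eqb (proj e) v) E).
Proof. intros H. unfold flux. now rewrite nodup_fixed_point. Qed.

Lemma flux_zero proj E f v : (forall e, In e E -> proj e <> v) -> flux proj E f v = 0.
Proof.
  intros H. apply sumR_zero. intros e He. apply filter_In in He as [He Hv].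
  apply nodup_In in He. apply Nat.eqb_eq in Hv. now destruct (H e).
Qed.

Lemma flux_nonneg proj E f v : (forall e, In e E -> 0 <= f e) -> 0 <= flux proj E f v.
Proof.
  intros H. apply sumR_nonneg. intros e He. apply filter_In in He as [He _].
  apply nodup_In in He. auto.
Qed.

Lemma flux_union proj E E1 E2 f v :
  (forall e, In e E <-> In e E1 \/ In e E2) -> (forall e, In e E1 -> In e E2 -> False) ->
  flux proj E f v = flux proj E1 f v + flux proj E2 f v.
Proof.
  intros HE Hd. unfold flux. rewrite <- sumR_app, <- filter_app.
  apply sumR_perm, NoDup_Permutation.
  - apply NoDup_filter, NoDup_nodup.
  - apply NoDup_filter, NoDup_app; try apply NoDup_nodup.
    intros e H1 H2. rewrite nodup_In in H1, H2. eauto.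
  - intros e. rewrite !filter_In, in_app_iff, !nodup_In, HE. tauto.
Qed.

Lemma flux_piece proj G1 G2 E f v :
  (forall e, In e E <-> In e (gE G1) \/ In e (gE G2)) ->
  (forall e, In e (gE G1) -> In e (gE G2) -> False) ->
  proj = fst \/ proj = snd -> TTSP G1 -> TTSP G2 ->
  (~ In v (gV G2) -> flux proj E f v = flux proj (gE G1) f v) /\
  (~ In v (gV G1) -> flux proj E f v = flux proj (gE G2) f v).
Proof.
  intros HE Hd Hp T1 T2. rewrite (flux_union _ _ _ _ _ _ HE Hd).
  split; intros Hv; [rewrite (flux_zero proj (gE G2))|rewrite (flux_zero proj (gE G1))]; try lra.
  all: intros [a b] He <-; apply Hv; destruct Hp as [-> | ->]; simpl; eauto.
Qed.

Lemma flux_src E1 f G : TTSP G -> incl E1 (gE G) -> flux snd E1 f (gs G) = 0.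
Proof.
  intros T I. apply flux_zero. intros [a b] He; simpl; intros ->.
  apply (ttsp_src _ (TTSP_wf _ T) a); auto.
Qed.

Lemma flux_snk E1 f G : TTSP G -> incl E1 (gE G) -> flux fst E1 f (gt G) = 0.
Proof.
  intros T I. apply flux_zero. intros [a b] He; simpl; intros ->.
  apply (ttsp_snk _ (TTSP_wf _ T) b); auto.
Qed.

(** * Conservation and the exchange of flows *)

Definition conserved (G : graph) (f : nat * nat -> R) : Prop :=
  forall v, In v (gV G) -> v <> gs G -> v <> gt G -> flux snd (gE G) f v = flux fst (gE G) f v.

(** Unlike [TTSP_parallel], the constructor [TTSP_series] does not demand this. It follows because a
    common edge would leave the sink of [G1]. *)
Lemma series_edge_disjoint G1 G2 :
  TTSP G1 -> TTSP G2 -> (forall v, In v (gV G1) -> In v (gV G2) -> v = gt G1) ->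
  forall e, In e (gE G1) -> In e (gE G2) -> False.
Proof.
  intros T1 T2 Hint [a b] H1 H2.
  assert (a = gt G1) by (apply Hint; eauto). subst a.
  exact (ttsp_snk _ (TTSP_wf _ T1) _ H1).
Qed.

(** The junction is an inner vertex of [G], and conservation there identifies the value that leaves
    [G1] with the value that enters [G2]. *)
Lemma flux_series G1 G2 G f :
  TTSP G1 -> TTSP G2 -> is_series G1 G2 G -> conserved G f ->
  conserved G1 f /\ conserved G2 f /\
  flux fst (gE G) f (gs G) = flux fst (gE G1) f (gs G1) /\
  flux snd (gE G) f (gt G) = flux snd (gE G2) f (gt G2) /\
  flux snd (gE G1) f (gt G1) = flux fst (gE G2) f (gs G2) /\
  flux fst (gE G) f (gt G1) = flux fst (gE G2) f (gs G2).
Proof.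
  intros T1 T2 (S1 & S2 & S3 & S4 & S5 & S6) C.
  pose proof (series_edge_disjoint _ _ T1 T2 S2) as Hd.
  pose proof (fun p v Hp => flux_piece p G1 G2 (gE G) f v S6 Hd Hp T1 T2) as HP.
  pose proof (TTSP_wf _ T1) as F1; pose proof (TTSP_wf _ T2) as F2.
  assert (Ns : ~ In (gs G1) (gV G2)) by (intros H; apply (ttsp_st _ F1), S2; auto).
  assert (Nt : ~ In (gt G2) (gV G1)).
  { intros H; apply (ttsp_st _ F2). rewrite <- S1. symmetry. apply S2; auto. }
  assert (M1 : flux snd (gE G) f (gt G1) = flux snd (gE G1) f (gt G1)).
  { rewrite (flux_union _ _ _ _ _ _ S6 Hd), S1, (flux_src (gE G2) f G2) by auto using incl_refl. lra. }
  assert (M2 : flux fst (gE G) f (gt G1) = flux fst (gE G2) f (gs G2)).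
  { rewrite (flux_union _ _ _ _ _ _ S6 Hd), (flux_snk (gE G1) f G1), S1 by auto using incl_refl. lra. }
  repeat split.
  - intros v Hv Nvs Nvt.
    assert (Nv : ~ In v (gV G2)) by auto.
    rewrite <- (proj1 (HP snd v (or_intror eq_refl)) Nv), <- (proj1 (HP fst v (or_introl eq_refl)) Nv).
    apply C.
    + apply S5; auto.
    + congruence.
    + intros ->. apply Nv. rewrite S4; auto.
  - intros v Hv Nvs Nvt.
    assert (Nv : ~ In v (gV G1)) by (intros H; apply Nvs; rewrite <- S1; auto).
    rewrite <- (proj2 (HP snd v (or_intror eq_refl)) Nv), <- (proj2 (HP fst v (or_introl eq_refl)) Nv).
    apply C.
    + apply S5; auto.
    + intros ->. apply Nv. rewrite S3; auto.
    + congruence.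
  - rewrite S3. apply HP; auto.
  - rewrite S4. apply HP; auto.
  - rewrite <- M1, <- M2. apply C.
    + apply S5; auto.
    + intros H. apply Ns. rewrite <- S3, <- H, S1; auto.
    + intros H. apply Nt. rewrite <- S4, <- H; auto.
  - exact M2.
Qed.

Lemma flux_parallel G1 G2 G f :
  TTSP G1 -> TTSP G2 -> gs G1 = gs G2 -> gt G1 = gt G2 ->
  (forall v, In v (gV G1) -> In v (gV G2) -> v = gs G1 \/ v = gt G1) ->
  (forall e, In e (gE G1) -> In e (gE G2) -> False) ->
  gs G = gs G1 -> gt G = gt G1 ->
  (forall v, In v (gV G) <-> In v (gV G1) \/ In v (gV G2)) ->
  (forall e, In e (gE G) <-> In e (gE G1) \/ In e (gE G2)) ->
  conserved G f -> conserved G1 f /\ conserved G2 f.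
Proof.
  intros T1 T2 Hs12 Ht12 Hint Hd Hs Ht HV HE C.
  pose proof (fun p v Hp => flux_piece p G1 G2 (gE G) f v HE Hd Hp T1 T2) as HP.
  split; intros v Hv Nvs Nvt.
  - assert (Nv : ~ In v (gV G2)) by (intros H; destruct (Hint v); auto).
    rewrite <- (proj1 (HP snd v (or_intror eq_refl)) Nv), <- (proj1 (HP fst v (or_introl eq_refl)) Nv).
    apply C; try congruence. apply HV; auto.
  - assert (Nv : ~ In v (gV G1)) by (intros H; destruct (Hint v); congruence).
    rewrite <- (proj2 (HP snd v (or_intror eq_refl)) Nv), <- (proj2 (HP fst v (or_introl eq_refl)) Nv).
    apply C; try congruence. apply HV; auto.
Qed.

Lemma flux_balance G f : TTSP G -> conserved G f ->
  flux fst (gE G) f (gs G) = flux snd (gE G) f (gt G).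
Proof.
  induction 1 as [G Hst HV HE
    |G1 G2 G T1 IH1 T2 IH2 Hm Hint Hs Ht HV HE
    |G1 G2 G T1 IH1 T2 IH2 Hs12 Ht12 Hint Hdis Hs Ht HV HE]; intros C.
  - unfold flux. f_equal. apply filter_ext_in. intros e He.
    apply nodup_In, HE in He as ->. simpl. now rewrite !Nat.eqb_refl.
  - assert (HS : is_series G1 G2 G) by (repeat split; auto; intros; try apply HV; try apply HE; auto).
    destruct (flux_series _ _ _ _ T1 T2 HS C) as (C1 & C2 & E1 & E2 & E3 & E4).
    rewrite E1, E2, IH1, E3, IH2; auto.
  - destruct (flux_parallel G1 G2 G f) as [C1 C2]; auto.
    rewrite !(flux_union _ _ _ _ _ _ HE Hdis), Hs, Ht, IH1, Hs12, Ht12, IH2; auto.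
Qed.

(** [Rel] is abstract because two comparisons are needed, [<] and [<=] with a positive right side.
    In a series composition both factors carry the full value, so [Rel] holds for each and the two
    paths are joined. In a parallel composition the values add up, and the hypothesis on [Rel]
    selects a factor. *)
Lemma TTSP_flow_exchange (Rel : R -> R -> Prop) :
  (forall x1 x2 y1 y2, 0 <= x1 -> 0 <= x2 -> 0 <= y1 -> 0 <= y2 ->
     Rel (x1 + x2) (y1 + y2) -> Rel x1 y1 \/ Rel x2 y2) ->
  forall G, TTSP G -> forall f g,
  (forall e, In e (gE G) -> 0 <= f e) -> (forall e, In e (gE G) -> 0 <= g e) ->
  conserved G f -> conserved G g ->
  Rel (flux fst (gE G) f (gs G)) (flux fst (gE G) g (gs G)) ->
  exists q, path (gE G) (gs G) q (gt G) /\
    (forall e, In e (walk_edges (gs G :: q)) -> Rel (f e) (g e)) /\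
    (forall v, In v q -> v <> gt G -> Rel (flux fst (gE G) f v) (flux fst (gE G) g v)).
Proof.
  intros HR. induction 1 as [G Hst HV HE
    |G1 G2 G T1 IH1 T2 IH2 Hm Hint Hs Ht HV HE
    |G1 G2 G T1 IH1 T2 IH2 Hs12 Ht12 Hint Hdis Hs Ht HV HE]; intros f g Pf Pg Cf Cg HRel.
  - exists [gt G]. split; [apply path_one; now apply HE|]. split.
    + intros e [<-|[]].
      (* The list may repeat the only edge; [flux_union] with an empty second part replaces it by a
         singleton. *)
      assert (K : forall h, flux fst (gE G) h (gs G) = h (gs G, gt G)).
      { intros h. rewrite (flux_union _ (gE G) [(gs G, gt G)] []) by (simpl; firstorder).
        unfold flux; simpl. rewrite Nat.eqb_refl; simpl. lra. }
      now rewrite !K in HRel.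
    + intros v [<-|[]]; easy.
  - assert (HS : is_series G1 G2 G) by (repeat split; auto; intros; try apply HV; try apply HE; auto).
    destruct (flux_series _ _ _ _ T1 T2 HS Cf) as (Cf1 & Cf2 & Ef1 & Ef2 & Ef3 & Ef4).
    destruct (flux_series _ _ _ _ T1 T2 HS Cg) as (Cg1 & Cg2 & Eg1 & Eg2 & Eg3 & Eg4).
    pose proof (fun h p v Hp => flux_piece p G1 G2 (gE G) h v HE
                 (series_edge_disjoint _ _ T1 T2 Hint) Hp T1 T2) as HP.
    destruct (IH1 f g) as (q1 & Q1 & R1 & V1); auto;
      [intros; apply Pf, HE; auto|intros; apply Pg, HE; auto|now rewrite <- Ef1, <- Eg1|].
    destruct (IH2 f g) as (q2 & Q2 & R2 & V2); auto;
      [intros; apply Pf, HE; auto|intros; apply Pg, HE; auto| |].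
    { now rewrite <- Ef3, <- Eg3, <- !flux_balance, <- Ef1, <- Eg1. }
    exists (q1 ++ q2). rewrite Hs, Ht. repeat split.
    + apply (path_app _ _ _ (gs G2)); [rewrite <- Hm|]; (eapply path_incl; [|eassumption]); eauto.
    + intros e He. rewrite (walk_edges_app _ _ _ _ _ Q1) in He.
      apply in_app_iff in He as [He|He]; [auto|]. rewrite Hm in He; auto.
    + intros v Hv Nv. apply in_app_iff in Hv as [Hv|Hv].
      (* The whole flow passes through the junction, so [Rel] holds there by the assumption on the
         values. *)
      * destruct (Nat.eq_dec v (gt G1)) as [->|Nm].
        { now rewrite Ef4, Eg4, <- Ef3, <- Eg3, <- !flux_balance, <- Ef1, <- Eg1. }
        assert (Nv2 : ~ In v (gV G2)).
        { intros H. apply Nm, Hint; auto. eapply path_vertices; eauto. }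
        rewrite !(proj1 (HP _ fst v (or_introl eq_refl)) Nv2). auto.
      * assert (Nv1 : ~ In v (gV G1)).
        { intros H. assert (v = gs G2) as ->.
          { rewrite <- Hm. apply Hint; auto. eapply path_vertices; eauto. }
          destruct (path_in_edge _ _ _ _ _ Q2 Hv) as [u Hu].
          exact (ttsp_src _ (TTSP_wf _ T2) _ Hu). }
        rewrite !(proj2 (HP _ fst v (or_introl eq_refl)) Nv1). auto.
  - destruct (flux_parallel G1 G2 G f) as [Cf1 Cf2]; auto.
    destruct (flux_parallel G1 G2 G g) as [Cg1 Cg2]; auto.
    pose proof (fun h p v Hp => flux_piece p G1 G2 (gE G) h v HE Hdis Hp T1 T2) as HP.
    assert (Pf1 : forall e, In e (gE G1) -> 0 <= f e) by (intros; apply Pf, HE; auto).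
    assert (Pf2 : forall e, In e (gE G2) -> 0 <= f e) by (intros; apply Pf, HE; auto).
    assert (Pg1 : forall e, In e (gE G1) -> 0 <= g e) by (intros; apply Pg, HE; auto).
    assert (Pg2 : forall e, In e (gE G2) -> 0 <= g e) by (intros; apply Pg, HE; auto).
    rewrite !(flux_union _ _ _ _ _ _ HE Hdis), Hs in HRel.
    apply HR in HRel; try (apply flux_nonneg; auto).
    destruct HRel as [HRel|HRel].
    + destruct (IH1 f g) as (q & Q & R & V); auto.
      exists q. rewrite Hs, Ht. repeat split; auto.
      * eapply path_incl; [|exact Q]; eauto.
      * intros v Hv Nv.
        assert (Nv2 : ~ In v (gV G2)).
        { intros H. destruct (Hint v); auto; [eapply path_vertices; eauto|].
          subst v. destruct (path_in_edge _ _ _ _ _ Q Hv) as [u Hu].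
          exact (ttsp_src _ (TTSP_wf _ T1) _ Hu). }
        rewrite !(proj1 (HP _ fst v (or_introl eq_refl)) Nv2). auto.
    + rewrite Hs12 in HRel. destruct (IH2 f g) as (q & Q & R & V); auto.
      exists q. rewrite Hs, Ht, Hs12, Ht12. repeat split; auto.
      * eapply path_incl; [|exact Q]; eauto.
      * intros v Hv Nv.
        assert (Nv1 : ~ In v (gV G1)).
        { intros H. destruct (Hint v); auto; [eapply path_vertices; eauto| |congruence].
          subst v. destruct (path_in_edge _ _ _ _ _ Q Hv) as [u Hu]. rewrite Hs12 in Hu.
          exact (ttsp_src _ (TTSP_wf _ T2) _ Hu). }
        rewrite !(proj2 (HP _ fst v (or_introl eq_refl)) Nv1). auto.
Qed.

(** * Edge loads of path flows *)

Definition same_edge (e e' : nat * nat) : bool :=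
  andb (Nat.eqb (fst e) (fst e')) (Nat.eqb (snd e) (snd e')).

Lemma same_edge_spec e e' : same_edge e e' = true <-> e = e'.
Proof.
  destruct e as [a b], e' as [c d]; unfold same_edge; simpl.
  rewrite Bool.andb_true_iff, !Nat.eqb_eq. split; [intros [-> ->]; auto|intros H; now injection H].
Qed.

Lemma ecount_pos e p : In e (walk_edges p) -> (1 <= ecount e p)%nat.
Proof.
  intros H. assert (K : In e (filter (same_edge e) (walk_edges p))).
  { apply filter_In. split; [exact H|now apply same_edge_spec]. }
  change (1 <= length (filter (same_edge e) (walk_edges p)))%nat.
  destruct (filter (same_edge e) (walk_edges p)); [destruct K|simpl; lia].
Qed.

Lemma ecount_zero e p : ~ In e (walk_edges p) -> ecount e p = 0%nat.
Proof.
  intros H. change (length (filter (same_edge e) (walk_edges p)) = 0%nat).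
  destruct (filter (same_edge e) (walk_edges p)) as [|e' l] eqn:El; [reflexivity|].
  assert (K : In e' (filter (same_edge e) (walk_edges p))) by (rewrite El; now left).
  apply filter_In in K as [K1 K2]. apply same_edge_spec in K2 as ->. easy.
Qed.

Lemma sumR_indicator E e (P : nat * nat -> bool) : NoDup E -> In e E ->
  sumR (fun e' => INR (if same_edge e' e then 1 else 0)) (filter P E) = INR (if P e then 1 else 0).
Proof.
  induction 1 as [|d E Hd ND IH]; [easy|]. intros [->|He].
  - assert (Z : sumR (fun e' => INR (if same_edge e' e then 1 else 0)) (filter P E) = 0).
    { apply sumR_zero. intros e' He'. apply filter_In in He' as [He' _].
      destruct (same_edge e' e) eqn:Es; [|reflexivity].
      apply same_edge_spec in Es as ->. easy. }
    simpl. destruct (P e); [|exact Z]. simpl. rewrite Z.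
    rewrite (proj2 (same_edge_spec e e) eq_refl). simpl; lra.
  - simpl. destruct (P d); [|auto]. simpl. rewrite IH by auto.
    destruct (same_edge d e) eqn:Es; [apply same_edge_spec in Es as ->; easy|simpl; lra].
Qed.

Lemma sumR_ecount E p (P : nat * nat -> bool) : NoDup E -> incl (walk_edges p) E ->
  sumR (fun e => INR (ecount e p)) (filter P E) = INR (length (filter P (walk_edges p))).
Proof.
  intros ND.
  change (incl (walk_edges p) E ->
    sumR (fun e => INR (length (filter (same_edge e) (walk_edges p)))) (filter P E)
    = INR (length (filter P (walk_edges p)))).
  induction (walk_edges p) as [|e l IH]; intros I.
  - now apply sumR_zero.
  - rewrite (sumR_ext _ (fun e' => INR (if same_edge e' e then 1 else 0)
                          + INR (length (filter (same_edge e') l)))).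
    + rewrite sumR_plus, sumR_indicator by auto with datatypes.
      rewrite IH by (eapply incl_cons_inv; eauto).
      rewrite <- plus_INR. f_equal. simpl. destruct (P e); reflexivity.
    + intros e' _. rewrite <- plus_INR. f_equal.
      simpl. destruct (same_edge e' e); reflexivity.
Qed.

Definition passes (proj : nat * nat -> nat) (v : nat) (p : list nat) : nat :=
  length (filter (fun e => Nat.eqb (proj e) v) (walk_edges p)).

(** Every position but the last is the tail of exactly one edge, and in [passes_in] every position
    but the first is the head of one. At vertices other than the two ends the counts agree, which is
    conservation. *)
Lemma passes_out E x q y v : path E x q y ->
  count_occ Nat.eq_dec (x :: q) v = (passes fst v (x :: q) + if Nat.eq_dec y v then 1 else 0)%nat.
Proof.
  induction 1 as [x|x a q z Ha H IH].
  - simpl. now destruct (Nat.eq_dec x v).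
  - change (passes fst v (x :: a :: q)) with
      (length (if Nat.eqb x v then (x, a) :: filter (fun e => Nat.eqb (fst e) v) (walk_edges (a :: q))
               else filter (fun e => Nat.eqb (fst e) v) (walk_edges (a :: q)))).
    change (count_occ Nat.eq_dec (x :: a :: q) v) with
      (if Nat.eq_dec x v then S (count_occ Nat.eq_dec (a :: q) v) else count_occ Nat.eq_dec (a :: q) v).
    rewrite IH. unfold passes.
    destruct (Nat.eq_dec x v) as [->|N]; [rewrite Nat.eqb_refl; reflexivity|].
    now rewrite (proj2 (Nat.eqb_neq _ _) N).
Qed.

Lemma passes_in E x q y v : path E x q y ->
  count_occ Nat.eq_dec (x :: q) v = (passes snd v (x :: q) + if Nat.eq_dec x v then 1 else 0)%nat.
Proof.
  induction 1 as [x|x a q z Ha H IH].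
  - simpl. now destruct (Nat.eq_dec x v).
  - change (passes snd v (x :: a :: q)) with
      (length (if Nat.eqb a v then (x, a) :: filter (fun e => Nat.eqb (snd e) v) (walk_edges (a :: q))
               else filter (fun e => Nat.eqb (snd e) v) (walk_edges (a :: q)))).
    change (count_occ Nat.eq_dec (x :: a :: q) v) with
      (if Nat.eq_dec x v then S (count_occ Nat.eq_dec (a :: q) v) else count_occ Nat.eq_dec (a :: q) v).
    rewrite IH. unfold passes.
    destruct (Nat.eq_dec a v) as [->|N].
    + rewrite Nat.eqb_refl. simpl. destruct (Nat.eq_dec x v); lia.
    + rewrite (proj2 (Nat.eqb_neq _ _) N). destruct (Nat.eq_dec x v); lia.
Qed.

Lemma edge_load_nonneg phi supp e : (forall p, 0 <= phi p) -> 0 <= edge_load phi supp e.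
Proof. intros H. apply sumR_nonneg. intros p _. apply Rmult_le_pos; auto using pos_INR. Qed.

Lemma edge_load_pos phi supp e : (forall p, 0 <= phi p) -> 0 < edge_load phi supp e ->
  exists p, In p supp /\ 0 < phi p /\ In e (walk_edges p).
Proof.
  intros H H0. apply sumR_pos in H0 as (p & Hp & H1).
  - exists p. split; [exact Hp|].
    destruct (in_dec edge_eq_dec e (walk_edges p)) as [Y|N].
    + split; [|exact Y]. destruct (Rle_lt_or_eq_dec _ _ (H p)) as [L|L]; [exact L|].
      rewrite <- L in H1. lra.
    + rewrite (ecount_zero _ _ N) in H1. simpl in H1. lra.
  - intros p. apply Rmult_le_pos; auto using pos_INR.
Qed.

Section Loads.
Variable G : graph.
Hypothesis HG : st_graph G.
Variables (phi : list nat -> R) (supp : list (list nat)).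
Hypothesis Hsupp : forall p, In p supp -> st_walk G p.

(** Double counting of the incidences of walks with edges at [v]; as the edge list of an [st]-graph
    has no repetitions, each edge is counted once. *)
Lemma flux_load proj v :
  flux proj (gE G) (edge_load phi supp) v = sumR (fun p => phi p * INR (passes proj v p)) supp.
Proof.
  pose proof HG as (_ & ND & _).
  rewrite flux_NoDup by exact ND. unfold edge_load.
  rewrite sumR_exchange. apply sumR_ext. intros p Hp.
  rewrite sumR_scal, sumR_ecount; auto. apply (Hsupp p Hp).
Qed.

Lemma passes_in_source p : st_walk G p -> passes snd (gs G) p = 0%nat.
Proof.
  intros Hp. unfold passes.
  destruct (filter _ (walk_edges p)) as [|e l] eqn:El; [reflexivity|].
  assert (K : In e (filter (fun e => Nat.eqb (snd e) (gs G)) (walk_edges p))) by (rewrite El; now left).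
  apply filter_In in K as [K1 K2]. apply Nat.eqb_eq in K2. destruct e as [a b]; simpl in K2; subst b.
  destruct HG as (_ & _ & _ & _ & _ & _ & Hs & _). destruct (Hs a). now apply (proj1 Hp).
Qed.

Lemma flux_load_out v : v <> gt G ->
  flux fst (gE G) (edge_load phi supp) v =
  sumR (fun p => phi p * INR (count_occ Nat.eq_dec p v)) supp.
Proof.
  intros N. rewrite flux_load. apply sumR_ext. intros p Hp.
  destruct (proj1 (st_walk_path _ _) (Hsupp p Hp)) as (q & -> & Q).
  rewrite (passes_out _ _ _ _ v Q). destruct (Nat.eq_dec (gt G) v); [congruence|].
  now rewrite Nat.add_0_r.
Qed.

Lemma flux_load_conserved : conserved G (edge_load phi supp).
Proof.
  intros v Hv Ns Nt. rewrite flux_load_out, flux_load by exact Nt. apply sumR_ext. intros p Hp.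
  destruct (proj1 (st_walk_path _ _) (Hsupp p Hp)) as (q & -> & Q).
  rewrite (passes_in _ _ _ _ v Q). destruct (Nat.eq_dec (gs G) v); [congruence|].
  now rewrite Nat.add_0_r.
Qed.

(** Each walk visits the source exactly once, because no edge enters it. *)
Lemma flux_load_value : flux fst (gE G) (edge_load phi supp) (gs G) = sumR phi supp.
Proof.
  pose proof HG as (_ & _ & _ & _ & Nst & _).
  rewrite flux_load_out by exact Nst. apply sumR_ext. intros p Hp.
  pose proof (passes_in_source p (Hsupp p Hp)) as Hz.
  destruct (proj1 (st_walk_path _ _) (Hsupp p Hp)) as (q & -> & Q).
  rewrite (passes_in _ _ _ _ _ Q), Hz.
  destruct (Nat.eq_dec (gs G) (gs G)); [simpl; lra|easy].
Qed.

End Loads.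

Lemma subgraph_walk H G p : subgraph H G -> st_walk H p -> st_walk G p.
Proof.
  intros (Hs & Ht & _ & IE & _) Hp. apply st_walk_path in Hp as (q & -> & Q).
  apply st_walk_path. rewrite <- Hs, <- Ht. eauto using path_incl.
Qed.

(** * TTSP graphs are neither edge-weak, nor weak, nor vulnerable *)

Lemma evalue_flux G h : st_graph G -> evalue G h = flux fst (gE G) h (gs G).
Proof.
  intros (_ & ND & _ & _ & _ & _ & Hs & _). unfold evalue, out_sum, in_sum.
  rewrite <- !flux_NoDup by exact ND. rewrite (flux_zero snd); [lra|].
  intros [x y] He; simpl; intros ->. exact (Hs _ He).
Qed.

Lemma TTSP_not_edge_weak G : st_graph G -> TTSP G -> ~ edge_weak G.
Proof.
  intros HG T (c & f & m & Hc & [Bf Cf] & Sat & ((g & [Bg Cg] & <-) & _) & Hlt).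
  pose proof HG as (_ & ND & _).
  rewrite !evalue_flux in Hlt by exact HG.
  destruct (TTSP_flow_exchange Rlt) with (G := G) (f := f) (g := g) as (q & Q & R & _); auto.
  - intros; destruct (Rlt_le_dec x1 y1); auto; lra.
  - intros e He. apply Bf, He.
  - intros e He. apply Bg, He.
  - intros v Hv Ns Nt. rewrite !flux_NoDup by exact ND. now apply Cf.
  - intros v Hv Ns Nt. rewrite !flux_NoDup by exact ND. now apply Cg.
  - destruct (Sat (gs G :: q)) as (e & He & Ee); [apply st_walk_path; eauto|].
    specialize (R e He). destruct (Bg e); [eapply path_edges; eauto|]. lra.
Qed.

(** If the inhibiting flow [phi] had a smaller value than the maximal flow [psi], the exchange in
    [G] would give a path on which the residual charges still admit one unit. *)
Lemma TTSP_subgraph_not_weak G H : st_graph G -> no_cycle (gE G) -> TTSP G -> subgraph H G -> ~ weak H.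
Proof.
  intros HG Hac T HH (eta & mn & mx & [Es Et] & [(phi & sp & [[[NDp [Wp Zp]] Fp] Inh] & <-) _]
    & [(psi & ss & [[NDs [Ws Zs]] Fs] & <-) Hmax] & Hne).
  pose proof (Hmax phi sp (conj (conj NDp (conj Wp Zp)) Fp)) as Hle.
  assert (Hlt : (nvalue phi sp < nvalue psi ss)%nat) by lia. clear Hmax Hne Hle.
  set (fp p := INR (phi p)). set (fs p := INR (psi p)).
  assert (Wp' : forall p, In p sp -> st_walk G p) by eauto using subgraph_walk.
  assert (Ws' : forall p, In p ss -> st_walk G p) by eauto using subgraph_walk.
  assert (Pp : forall p, 0 <= fp p) by (intros; apply pos_INR).
  assert (Ps : forall p, 0 <= fs p) by (intros; apply pos_INR).
  assert (Hload : forall f sup v, (forall p, In p sup -> st_walk G p) -> v <> gt G ->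
            flux fst (gE G) (edge_load (fun p => INR (f p)) sup) v = INR (nload f sup v)).
  { intros f sup v Hw Nv. rewrite flux_load_out by auto. unfold nload. rewrite sumN_INR.
    apply sumR_ext. intros p _. rewrite mult_INR. ring. }
  destruct (TTSP_flow_exchange Rlt) with (G := G) (f := edge_load fp sp) (g := edge_load fs ss)
    as (q & Q & R & V); auto using edge_load_nonneg, flux_load_conserved.
  - intros; destruct (Rlt_le_dec x1 y1); auto; lra.
  - rewrite !flux_load_value by auto. unfold fp, fs. rewrite <- !sumN_INR. now apply lt_INR.
  - pose proof HH as (Hs & Ht & IV & IE & HstH).
    (* On each edge the load of [psi] exceeds a nonnegative number, so some walk of [H] uses that
       edge. *)
    assert (QH : st_walk H (gs H :: q)).
    { apply st_walk_path. exists q. split; [reflexivity|]. rewrite Hs, Ht.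
      apply path_self in Q. eapply path_incl; [|exact Q]. intros e He.
      specialize (R e He).
      destruct (edge_load_pos fs ss e) as (p & Hp & _ & Hin); auto.
      - eapply Rle_lt_trans; [|exact R]. apply edge_load_nonneg; auto.
      - apply (proj1 (Ws p Hp)), Hin. }
    assert (exists one : list nat -> nat,
      one (gs H :: q) = 1%nat /\ forall p, one p <> 0%nat -> gs H :: q = p) as (one & O1 & O2).
    { exists (fun p => if list_eq_dec Nat.eq_dec (gs H :: q) p then 1%nat else 0%nat). split.
      - now destruct (list_eq_dec Nat.eq_dec (gs H :: q) (gs H :: q)).
      - intros p. now destruct (list_eq_dec Nat.eq_dec (gs H :: q) p). }
    apply Inh. exists one, [gs H :: q]. unfold nvalue, sumN, fold_right. rewrite O1.
    split; [split; [split; [|split]|]|lia].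
    + apply NoDup_cons; [easy|apply NoDup_nil].
    + intros p [<-|[]]; auto.
    + intros p Hp. left. now apply O2.
    + intros v Hv. unfold residual. destruct (eta v) as [k|] eqn:Ev; [|exact I].
      assert (Nvs : v <> gs H) by congruence. assert (Nvt : v <> gt H) by congruence.
      assert (L1 : nload one [gs H :: q] v = count_occ Nat.eq_dec q v).
      { unfold nload, sumN, fold_right. rewrite O1, count_occ_cons_neq by congruence. lia. }
      unfold fits. rewrite L1.
      destruct (in_dec Nat.eq_dec v q) as [Hq|Hq].
      * assert (C1 : (count_occ Nat.eq_dec q v <= 1)%nat).
        { apply (NoDup_count_occ Nat.eq_dec). pose proof (no_cycle_NoDup _ _ _ _ Hac Q) as ND.
          now inversion ND. }
        rewrite Ht in Nvt. specialize (V v Hq Nvt).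
        unfold fp, fs in V. rewrite !Hload in V by auto. apply INR_lt in V.
        specialize (Fs v Hv). rewrite Ev in Fs. simpl in Fs. lia.
      * rewrite (proj1 (count_occ_not_In _ _ _) Hq). lia.
Qed.

(** * Shortest paths in a Wardrop flow *)

Section LoadedPaths.
Variables (H : graph) (r : R) (l : nat * nat -> R -> R).
Variables (phi : list nat -> R) (supp : list (list nat)).
Hypotheses (HH : st_graph H) (W : wardrop H r l phi supp).

Let lat x q := path_lat l phi supp (x :: q).

Lemma path_lat_app x q y q' : path (gE H) x q y -> lat x (q ++ q') = lat x q + lat y q'.
Proof. intros Q. unfold lat, path_lat. now rewrite (walk_edges_app _ _ _ _ _ Q), sumR_app. Qed.

(* A prefix of a used path can be exchanged for any other path to the same vertex, so every
   prefix of a used path is shortest; by induction so is a path whose edges are all loaded,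
   even if that path itself is not used. *)
Lemma loaded_path_shortest q v :
  path (gE H) (gs H) q v ->
  (forall e, In e (walk_edges (gs H :: q)) -> 0 < edge_load phi supp e) ->
  forall w, path (gE H) (gs H) w v -> lat (gs H) q <= lat (gs H) w.
Proof.
  destruct W as ((ND & Wp & Zp & Pp) & _ & Hopt).
  revert v; induction q as [|v' q IH] using rev_ind; intros v Q Hpos w Ww.
  - apply path_nil_eq in Q as <-. destruct w as [|a w]; [lra|exfalso].
    apply path_cons_inv in Ww as [Ha Ww].
    destruct HH as (_ & _ & _ & _ & _ & _ & Hs & _).
    destruct (path_split_tail (gE H) (gs H) (a :: w) (gs H) (gs H)) as (q1 & q2 & _ & P1 & _).
    { eauto. }
    { exact (path_end_in _ _ _ _ Ww). }
    apply path_app_inv in P1 as (b & _ & Hb). apply path_cons_inv in Hb as [Hb _].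
    exact (Hs _ Hb).
  - apply path_app_inv in Q as (u & Q & Qv).
    pose proof Qv as Qv'. apply path_cons_inv in Qv' as [Huv Qn]. apply path_nil_eq in Qn as ->.
    rewrite (walk_edges_app _ _ _ _ _ Q) in Hpos.
    destruct (edge_load_pos phi supp (u, v)) as (p & Hp & Hphi & Hin); auto.
    { apply Hpos, in_app_iff. right; now left. }
    destruct (proj1 (st_walk_path _ _) (Wp p Hp)) as (p' & -> & P).
    destruct (path_edge_split _ _ _ _ _ _ P Hin) as (p1 & p2 & -> & P1 & P2).
    rewrite (path_lat_app _ _ _ _ Q).
    assert (Hq : lat (gs H) q <= lat (gs H) p1).
    { apply (IH u); auto. intros e He. apply Hpos, in_app_iff. now left. }
    assert (Hw : st_walk H (gs H :: w ++ p2)).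
    { apply st_walk_path. eauto using path_app. }
    specialize (Hopt _ _ Hp Hphi Hw).
    change (lat (gs H) (p1 ++ v :: p2) <= lat (gs H) (w ++ p2)) in Hopt.
    change (v :: p2) with ([v] ++ p2) in Hopt.
    rewrite (path_lat_app _ _ _ _ P1), (path_lat_app _ _ _ _ Qv), (path_lat_app _ _ _ _ Ww) in Hopt.
    lra.
Qed.

End LoadedPaths.

Lemma wardrop_used G r l phi supp : wardrop G r l phi supp -> 0 < r ->
  exists p, In p supp /\ 0 < phi p.
Proof.
  intros ((_ & _ & _ & Pp) & <- & _) Hr. now apply sumR_pos.
Qed.

(** Let [q] be the path obtained by the exchange. The latency in [G] is at most that of [q] under
    [phi], by the Wardrop condition. This is at most that of [q] under [psi], by monotonicity, and
    the latter is at most the latency in [H], because [q] is a loaded path of [H] and therefore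
    shortest. *)
Lemma TTSP_not_vulnerable G : st_graph G -> TTSP G -> ~ vulnerable G.
Proof.
  intros HG T (r & l & H & x & y & Hr & Hl & HH & (phi & sp & Wf & Lx & Zx)
    & (psi & ss & Wg & Ly & Zy) & Hlt).
  (* For [r = 0] there is no used path, and [is_L] sets both latencies to 0. *)
  destruct (Rle_lt_or_eq_dec _ _ Hr) as [Hr'|Hr0]; [|rewrite Zx, Zy in Hlt by auto; lra].
  pose proof Wf as ((_ & Wp & _ & Pp) & Vp & Op).
  pose proof Wg as ((_ & Ws & _ & Ps) & Vs & Os).
  assert (Ws' : forall p, In p ss -> st_walk G p) by eauto using subgraph_walk.
  destruct (TTSP_flow_exchange (fun a b => a <= b /\ 0 < b))
    with (G := G) (f := edge_load phi sp) (g := edge_load psi ss) as (q & Q & R & _);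
    auto using edge_load_nonneg, flux_load_conserved.
  (* If the first pair fails, then either [x1 > y1], hence [0 <= x2 < y2], or [x1 = y1 = 0], and the
     second pair is the whole sum. *)
  { intros x1 x2 y1 y2 X1 X2 Y1 Y2 [A B].
    destruct (Rle_lt_dec x1 y1); [|right; lra].
    destruct (Rle_lt_or_eq_dec _ _ Y1); [left|right]; lra. }
  { rewrite !flux_load_value by auto. lra. }
  pose proof HH as (Hs & Ht & IV & IE & HstH).
  destruct (wardrop_used _ _ _ _ _ Wf Hr') as (p & Hp & Fp).
  destruct (wardrop_used _ _ _ _ _ Wg Hr') as (p' & Hp' & Fp').
  rewrite <- (Lx p Hp Fp), <- (Ly p' Hp' Fp') in Hlt.
  assert (QH : path (gE H) (gs H) q (gt H)).
  { rewrite Hs, Ht. apply path_self in Q. eapply path_incl; [|exact Q]. intros e He.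
    destruct (edge_load_pos psi ss e) as (w & Hw & _ & Hin); [auto|apply R; auto|].
    apply (proj1 (Ws w Hw)), Hin. }
  assert (A1 : path_lat l phi sp p <= path_lat l phi sp (gs G :: q)).
  { apply Op; auto. apply st_walk_path; eauto. }
  assert (A2 : path_lat l phi sp (gs G :: q) <= path_lat l psi ss (gs G :: q)).
  { apply sumR_le. intros e He. apply (Hl e); [eapply path_edges; eauto| |apply R; auto].
    apply edge_load_nonneg; auto. }
  destruct (proj1 (st_walk_path _ _) (Ws p' Hp')) as (w & -> & Pw).
  assert (A3 : path_lat l psi ss (gs H :: q) <= path_lat l psi ss (gs H :: w)).
  { eapply loaded_path_shortest; eauto. rewrite Hs. intros e He. apply R; auto. }
  rewrite Hs in A3, Hlt. lra.
Qed.

(** * Graphs containing a Wheatstone bridge *)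

(** A union of walks from source to sink satisfies the covering condition of [st_graph] by
    construction; duplicates are removed because [st_graph] forbids them. *)
Lemma walks_subgraph G ps : st_graph G -> ps <> [] -> (forall p, In p ps -> st_walk G p) ->
  subgraph (mkG (nodup Nat.eq_dec (concat ps)) (nodup edge_eq_dec (concat (map walk_edges ps)))
              (gs G) (gt G)) G.
Proof.
  intros HG Hne Hps.
  set (H := mkG _ _ _ _).
  assert (VE : forall v, In v (gV H) <-> exists p, In p ps /\ In v p).
  { intros v. simpl. rewrite nodup_In, in_concat. firstorder. }
  assert (EE : forall e, In e (gE H) <-> exists p, In p ps /\ In e (walk_edges p)).
  { intros e. simpl. rewrite nodup_In, in_concat. split.
    - intros (x & Hx & He). apply in_map_iff in Hx as (p & <- & Hp). eauto.
    - intros (p & Hp & He). exists (walk_edges p). split; [apply in_map|]; auto. }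
  assert (WH : forall p, In p ps -> st_walk H p).
  { intros p Hp. pose proof (Hps p Hp) as W. apply st_walk_path in W as (q & -> & Q).
    apply st_walk_path. exists q. split; [reflexivity|].
    eapply path_incl; [|exact (path_self _ _ _ _ Q)]. intros e He. apply EE. eauto. }
  assert (IE : incl (gE H) (gE G)).
  { intros e He. apply EE in He as (p & Hp & He). now apply (Hps p Hp). }
  assert (IV : incl (gV H) (gV G)).
  { intros v Hv. apply VE in Hv as (p & Hp & Hv).
    destruct (proj1 (st_walk_path _ _) (Hps p Hp)) as (q & -> & Q).
    pose proof HG as (_ & _ & Vs & _). destruct Hv as [<-|Hv]; [exact Vs|].
    destruct (path_in_edge _ _ _ _ _ Q Hv) as [w Hw]. now apply (st_graph_ends G HG) in Hw. }
  pose proof HG as (_ & _ & _ & _ & Nst & HE & Hs & Ht & _).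
  destruct ps as [|p0 ps]; [easy|].
  destruct (proj1 (st_walk_path _ _) (Hps p0 (or_introl eq_refl))) as (q0 & E0 & Q0).
  repeat split; auto.
  - apply NoDup_nodup.
  - apply NoDup_nodup.
  - apply VE. exists p0. subst p0. split; now left.
  - apply VE. exists p0. subst p0. split; [now left|]. exact (path_end_in _ _ _ _ Q0).
  - apply VE. apply EE in H0 as (p & Hp & He). apply walk_edges_vertices in He. firstorder.
  - apply VE. apply EE in H0 as (p & Hp & He). apply walk_edges_vertices in He as [_ He].
    exists p. split; auto. destruct p; [destruct He|now right].
  - apply IE in H0. now apply HE in H0.
  - intros w Hw. apply (Hs w). now apply IE.
  - intros w Hw. apply (Ht w). now apply IE.
  - intros w Hw. apply VE in Hw as (p & Hp & Hw). exists p. auto.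
Qed.

(** * Cuts and potentials *)

Lemma path_crosses_cut E x q y (C : nat -> bool) : path E x q y -> C x = false -> C y = true ->
  exists c d, In (c, d) (walk_edges (x :: q)) /\ C c = false /\ C d = true.
Proof.
  induction 1 as [x|x a q z Ha H IH]; intros Hx Hy; [congruence|].
  destruct (C a) eqn:Ca.
  - exists x, a. repeat split; auto. now left.
  - destruct (IH eq_refl Hy) as (c & d & Hin & ?). exists c, d. split; [now right|auto].
Qed.

(** A potential whose increments are bounded by the edge lengths bounds path lengths from below.
    With [path_potential_eq] for tight edges it certifies shortest paths without inspecting the
    competing ones. *)
Lemma path_potential_le E x q y (d : nat -> R) (w : nat * nat -> R) : path E x q y ->
  (forall e, In e (walk_edges (x :: q)) -> d (snd e) - d (fst e) <= w e) ->
  d y - d x <= sumR w (walk_edges (x :: q)).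
Proof.
  induction 1 as [x|x a q z Ha H IH]; intros Hw; [simpl; lra|].
  change (walk_edges (x :: a :: q)) with ((x, a) :: walk_edges (a :: q)) in *. rewrite sumR_cons.
  assert (d a - d x <= w (x, a)) by (apply (Hw (x, a)); now left).
  assert (d z - d a <= sumR w (walk_edges (a :: q))) by (apply IH; intros; apply Hw; now right).
  lra.
Qed.

Lemma path_potential_eq E x q y (d : nat -> R) (w : nat * nat -> R) : path E x q y ->
  (forall e, In e (walk_edges (x :: q)) -> w e = d (snd e) - d (fst e)) ->
  sumR w (walk_edges (x :: q)) = d y - d x.
Proof.
  induction 1 as [x|x a q z Ha H IH]; intros Hw; [simpl; lra|].
  change (walk_edges (x :: a :: q)) with ((x, a) :: walk_edges (a :: q)) in *. rewrite sumR_cons.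
  rewrite IH by (intros; apply Hw; now right).
  rewrite (Hw (x, a)) by now left. cbn [fst snd]. lra.
Qed.

Lemma ecount_le_1 e p : NoDup p -> (ecount e p <= 1)%nat.
Proof.
  induction p as [|x [|y p] IH]; intros ND; [unfold ecount; simpl; lia..|].
  inversion ND as [|? ? Hx ND']; subst. specialize (IH ND').
  change (length (filter (same_edge e) ((x, y) :: walk_edges (y :: p))) <= 1)%nat. simpl filter.
  destruct (same_edge e (x, y)) eqn:Es; [|exact IH].
  apply same_edge_spec in Es as ->. simpl length.
  assert (Z : ecount (x, y) (y :: p) = 0%nat).
  { apply ecount_zero. intros He. apply walk_edges_vertices in He. tauto. }
  change (S (ecount (x, y) (y :: p)) <= 1)%nat. now rewrite Z.
Qed.

Lemma NoDup_app_disj {A} (l l' : list A) : NoDup (l ++ l') ->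
  NoDup l' /\ forall x, In x l -> In x l' -> False.
Proof.
  induction l as [|a l IH]; intros ND; [split; [exact ND|easy]|].
  inversion ND as [|? ? Ha ND']; subst. destruct (IH ND') as [N D]. split; [exact N|].
  intros x [<-|Hx] Hx'; [apply Ha, in_app_iff; auto|eauto].
Qed.

Definition unit_flow (l : list (list nat)) (p : list nat) : nat :=
  if in_dec (list_eq_dec Nat.eq_dec) p l then 1%nat else 0%nat.

Lemma sumN_ext {A} (f g : A -> nat) l : (forall x, In x l -> f x = g x) -> sumN f l = sumN g l.
Proof.
  induction l as [|x l IH]; intros H; [reflexivity|]. unfold sumN in *. simpl.
  rewrite IH, (H x); auto with datatypes.
Qed.

Lemma sumN_zero_inv {A} (f : A -> nat) l : sumN f l = 0%nat -> forall x, In x l -> f x = 0%nat.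
Proof.
  induction l as [|y l IH]; intros H x Hx; [easy|]. unfold sumN in *. simpl in H.
  destruct Hx as [<-|Hx]; [lia|apply IH; auto; lia].
Qed.

Lemma sumN_le_plus {A} (f g h : A -> nat) l :
  (forall x, In x l -> (f x <= g x + h x)%nat) -> (sumN f l <= sumN g l + sumN h l)%nat.
Proof.
  induction l as [|y l IH]; intros H; [simpl; lia|].
  assert (IH' : (sumN f l <= sumN g l + sumN h l)%nat) by (apply IH; auto with datatypes).
  assert (f y <= g y + h y)%nat by auto with datatypes.
  unfold sumN in *. simpl. lia.
Qed.

Lemma unit_flow_load l w :
  nload (unit_flow l) l w = sumN (fun p => count_occ Nat.eq_dec p w) l.
Proof.
  apply sumN_ext. intros p Hp. unfold unit_flow.
  destruct (in_dec (list_eq_dec Nat.eq_dec) p l); [lia|easy].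
Qed.

Lemma unit_flow_value l : nvalue (unit_flow l) l = length l.
Proof.
  transitivity (sumN (fun _ : list nat => 1%nat) l).
  - apply sumN_ext. intros p Hp. unfold unit_flow.
    now destruct (in_dec (list_eq_dec Nat.eq_dec) p l).
  - induction l as [|p l IH]; [reflexivity|exact (f_equal S IH)].
Qed.

Lemma unit_flow_nflow H l : NoDup l -> (forall p, In p l -> st_walk H p) -> nflow H (unit_flow l) l.
Proof.
  intros ND W. split; [exact ND|split; [exact W|]]. intros p Hp. unfold unit_flow in Hp.
  now destruct (in_dec (list_eq_dec Nat.eq_dec) p l).
Qed.

(** * The bridge with its stems, and its three walks *)

Section Bridge.
Variable G : graph.
Hypotheses (HG : st_graph G) (Hac : no_cycle (gE G)).
Variables (a u v b : nat) (LS LA LA' LB LB' LM LT : list nat).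
Hypotheses (PS : path (gE G) (gs G) LS a) (PT : path (gE G) b LT (gt G)).
Hypotheses (PA : path (gE G) a LA u) (PA' : path (gE G) u LA' b).
Hypotheses (PB : path (gE G) a LB v) (PB' : path (gE G) v LB' b).
Hypothesis PM : path (gE G) u LM v.
Hypotheses (Hu : In u LA) (Hv : In v LB) (Nub : u <> b) (Nvb : v <> b).
Hypothesis HPQ : forall z, In z (LA ++ LA') -> In z (LB ++ LB') -> z = b.
Hypothesis HM : forall z, In z LM -> ~ In z (LA ++ LA') /\ (In z (LB ++ LB') -> z = v).

Let s := gs G.
Let t := gt G.

Definition bridge_upper := s :: LS ++ LA ++ LA' ++ LT.
Definition bridge_lower := s :: LS ++ LB ++ LB' ++ LT.
Definition bridge_zigzag := s :: LS ++ LA ++ LM ++ LB' ++ LT.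

Notation X1 := bridge_upper.
Notation X2 := bridge_lower.
Notation X3 := bridge_zigzag.

Lemma path_upper : path (gE G) s (LS ++ LA ++ LA' ++ LT) t.
Proof. unfold s, t. eauto 6 using path_app. Qed.

Lemma path_lower : path (gE G) s (LS ++ LB ++ LB' ++ LT) t.
Proof. unfold s, t. eauto 6 using path_app. Qed.

Lemma path_zigzag : path (gE G) s (LS ++ LA ++ LM ++ LB' ++ LT) t.
Proof. unfold s, t. eauto 7 using path_app. Qed.

(* The bridge with its two stems has nine parts: the stem from [s] to [a] (0),
   the arm from [a] to [u] (1), [u] (2), the arm from [u] to [b] (3), the arm from [a] to [v] (4),
   [v] (5), the arm from [v] to [b] (6), the bridge from [u] to [v] (7, also used outside), and
   the stem from [b] to [t] (8). *)
Definition part (x : nat) : nat :=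
  if in_dec Nat.eq_dec x (s :: LS) then 0
  else if Nat.eq_dec x u then 2
  else if Nat.eq_dec x v then 5
  else if in_dec Nat.eq_dec x (b :: LT) then 8
  else if in_dec Nat.eq_dec x LA then 1
  else if in_dec Nat.eq_dec x LA' then 3
  else if in_dec Nat.eq_dec x LB then 4
  else if in_dec Nat.eq_dec x LB' then 6
  else 7.

Lemma NoDup_upper : NoDup X1.
Proof. exact (no_cycle_NoDup _ _ _ _ Hac path_upper). Qed.

Lemma NoDup_lower : NoDup X2.
Proof. exact (no_cycle_NoDup _ _ _ _ Hac path_lower). Qed.

Lemma NoDup_zigzag : NoDup X3.
Proof. exact (no_cycle_NoDup _ _ _ _ Hac path_zigzag). Qed.

Lemma bridge_distinct :
  u <> v /\ In b LA' /\ In b LB' /\ In v LM.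
Proof.
  assert (Nuv : u <> v) by (intros E; apply Nub, HPQ; apply in_app_iff; left; congruence).
  repeat split; auto; eapply path_end_tail; eauto.
Qed.

(** Two segments on a common walk among upper, lower and zigzag are disjoint because, by acyclicity,
    these walks repeat no vertex. Only pairs on no common walk, such as [LA] and [LB] or [LA'] and
    [LM], require [HPQ] and [HM]. *)
Lemma bridge_disjoint x :
  (In x (s :: LS) -> In x LA \/ In x LA' \/ In x LB \/ In x LB' \/ In x LM \/ In x LT -> False) /\
    (In x LA -> In x LA' \/ In x LB \/ In x LB' \/ In x LM \/ In x LT -> False) /\
    (In x LB -> In x LA' \/ In x LB' \/ In x LT \/ (In x LM /\ x <> v) -> False) /\
    (In x LA' -> In x LM \/ In x LT \/ (In x LB' /\ x <> b) -> False) /\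
    (In x LB' -> In x LM \/ In x LT -> False) /\ (In x LM -> In x LT -> False).
Proof.
  pose proof NoDup_upper as N1. pose proof NoDup_lower as N2. pose proof NoDup_zigzag as N3.
  change (NoDup ((s :: LS) ++ LA ++ LA' ++ LT)) in N1.
  change (NoDup ((s :: LS) ++ LB ++ LB' ++ LT)) in N2.
  change (NoDup ((s :: LS) ++ LA ++ LM ++ LB' ++ LT)) in N3.
  apply NoDup_app_disj in N1 as [N1 D1], N2 as [N2 D2], N3 as [N3 D3].
  apply NoDup_app_disj in N1 as [N1 D4], N2 as [N2 D5], N3 as [N3 D6].
  apply NoDup_app_disj in N1 as [N1 D7], N2 as [N2 D8], N3 as [N3 D9].
  apply NoDup_app_disj in N3 as [_ D10].
  destruct bridge_distinct as (Nuv & Bb & Bb' & Vm).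
  pose proof HPQ as HPQ'. pose proof HM as HM'.
  repeat match goal with
    | D : forall z, In z _ -> _ |- _ => progress (repeat setoid_rewrite in_app_iff in D)
    end.
  specialize (D1 x); specialize (D2 x); specialize (D3 x); specialize (D4 x); specialize (D5 x);
    specialize (D6 x); specialize (D7 x); specialize (D8 x); specialize (D9 x); specialize (D10 x).
    assert (P1 : In x LA -> x <> b) by (intros H ->; tauto).
    assert (P2 : In x LB -> x <> b) by (intros H ->; tauto).
    specialize (HPQ' x); specialize (HM' x). tauto.
Qed.

Lemma part_spec :
  (forall x, In x (s :: LS) -> part x = 0%nat) /\ part u = 2%nat /\ part v = 5%nat /\
  (forall x, In x (b :: LT) -> part x = 8%nat) /\
  (forall x, In x LA -> x <> u -> part x = 1%nat) /\
  (forall x, In x LA' -> x <> b -> part x = 3%nat) /\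
  (forall x, In x LB -> x <> v -> part x = 4%nat) /\
  (forall x, In x LB' -> x <> b -> part x = 6%nat) /\
  (forall x, In x LM -> x <> v -> part x = 7%nat).
Proof.
  destruct bridge_distinct as (Nuv & Bb & Bb' & Vm).
  pose proof (bridge_disjoint u) as Cu. pose proof (bridge_disjoint v) as Cv.
  pose proof (bridge_disjoint b) as Cb.
  assert (Hbt : forall x, In x (b :: LT) -> x = b \/ In x LT) by (intros x [H|H]; auto).
  unfold part.
  repeat split; try (intros x Hx; pose proof (bridge_disjoint x) as Cx;
    try intros Nx); clear HPQ HM.
  all: repeat match goal with
    | |- (if in_dec Nat.eq_dec ?x ?l then _ else _) = _ => destruct (in_dec Nat.eq_dec x l)
    | |- (if Nat.eq_dec ?x ?l then _ else _) = _ => destruct (Nat.eq_dec x l)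
    end; try reflexivity; exfalso;
    repeat match goal with H : In _ (b :: LT) |- _ => apply Hbt in H; destruct H end;
    subst; first [congruence | tauto
      | match goal with N : ~ In _ (b :: LT) |- _ => apply N; simpl; now auto end].
Qed.

Lemma part_2 x : part x = 2%nat -> x = u.
Proof.
  unfold part. repeat match goal with
    | |- (if ?D then _ else _) = _ -> _ => destruct D; [now intros|] end; now intros.
Qed.

Lemma part_5 x : part x = 5%nat -> x = v.
Proof.
  unfold part. repeat match goal with
    | |- (if ?D then _ else _) = _ -> _ => destruct D; [now intros|] end; now intros.
Qed.

Lemma path_edge_ends x q y c d : path (gE G) x q y -> In (c, d) (walk_edges (x :: q)) ->
  (c = x \/ In c q /\ c <> y) /\ In d q.
Proof.
  intros Q Hcd. pose proof (walk_edges_vertices _ _ _ Hcd) as [Hc Hd]. split; [|exact Hd].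
  destruct Hc as [Hc|Hc]; [now left|right]. split; [exact Hc|]. intros ->.
  destruct (path_edge_split _ _ _ _ _ _ Q Hcd) as (q1 & q2 & _ & _ & Q2).
  assert (Hyd : In (y, d) (gE G)) by exact (path_edges _ _ _ _ _ Q Hcd).
  pose proof (Hac _ _ (path_cons _ _ _ _ _ Hyd Q2)). easy.
Qed.

(** Turns the cut and potential arguments below into finite case analyses on the parts of the two
    ends of an edge. *)
Lemma edge_parts c d :
  (In (c, d) (walk_edges (s :: LS)) -> part c = 0%nat /\ part d = 0%nat) /\
  (In (c, d) (walk_edges (a :: LA)) ->
     (part c = 0%nat \/ part c = 1%nat) /\ (part d = 1%nat \/ part d = 2%nat)) /\
  (In (c, d) (walk_edges (u :: LA')) ->
     (part c = 2%nat \/ part c = 3%nat) /\ (part d = 3%nat \/ part d = 8%nat)) /\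
  (In (c, d) (walk_edges (a :: LB)) ->
     (part c = 0%nat \/ part c = 4%nat) /\ (part d = 4%nat \/ part d = 5%nat)) /\
  (In (c, d) (walk_edges (v :: LB')) ->
     (part c = 5%nat \/ part c = 6%nat) /\ (part d = 6%nat \/ part d = 8%nat)) /\
  (In (c, d) (walk_edges (u :: LM)) ->
     (part c = 2%nat \/ part c = 7%nat) /\ (part d = 7%nat \/ part d = 5%nat)) /\
  (In (c, d) (walk_edges (b :: LT)) -> part c = 8%nat /\ part d = 8%nat).
Proof.
  destruct part_spec as (C0 & C2 & C5 & C8 & C1 & C3 & C4 & C6 & C7).
  assert (Ca : part a = 0%nat) by (apply C0; exact (path_end_in _ _ _ _ PS)).
  assert (Cb : part b = 8%nat) by (apply C8; now left).
  repeat match goal with |- _ /\ _ => split end; intros H.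
  - apply walk_edges_vertices in H as [Hc Hd]. split; apply C0; [exact Hc|now right].
  - destruct (path_edge_ends _ _ _ _ _ PA H) as [[->|[Hc Nc]] Hd];
      (split; [auto|destruct (Nat.eq_dec d u) as [->|]; auto]).
  - destruct (path_edge_ends _ _ _ _ _ PA' H) as [[->|[Hc Nc]] Hd];
      (split; [auto|destruct (Nat.eq_dec d b) as [->|]; auto]).
  - destruct (path_edge_ends _ _ _ _ _ PB H) as [[->|[Hc Nc]] Hd];
      (split; [auto|destruct (Nat.eq_dec d v) as [->|]; auto]).
  - destruct (path_edge_ends _ _ _ _ _ PB' H) as [[->|[Hc Nc]] Hd];
      (split; [auto|destruct (Nat.eq_dec d b) as [->|]; auto]).
  - destruct (path_edge_ends _ _ _ _ _ PM H) as [[->|[Hc Nc]] Hd];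
      (split; [auto|destruct (Nat.eq_dec d v) as [->|]; auto]).
  - apply walk_edges_vertices in H as [Hc Hd]. split; apply C8; [exact Hc|now right].
Qed.

Lemma walk_edges_upper e : In e (walk_edges X1) <->
  In e (walk_edges (s :: LS)) \/ In e (walk_edges (a :: LA)) \/
  In e (walk_edges (u :: LA')) \/ In e (walk_edges (b :: LT)).
Proof.
  unfold bridge_upper. rewrite (walk_edges_app _ _ _ _ _ PS), (walk_edges_app _ _ _ _ _ PA),
    (walk_edges_app _ _ _ _ _ PA'), !in_app_iff. reflexivity.
Qed.

Lemma walk_edges_lower e : In e (walk_edges X2) <->
  In e (walk_edges (s :: LS)) \/ In e (walk_edges (a :: LB)) \/
  In e (walk_edges (v :: LB')) \/ In e (walk_edges (b :: LT)).
Proof.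
  unfold bridge_lower. rewrite (walk_edges_app _ _ _ _ _ PS), (walk_edges_app _ _ _ _ _ PB),
    (walk_edges_app _ _ _ _ _ PB'), !in_app_iff. reflexivity.
Qed.

Lemma walk_edges_zigzag e : In e (walk_edges X3) <->
  In e (walk_edges (s :: LS)) \/ In e (walk_edges (a :: LA)) \/ In e (walk_edges (u :: LM)) \/
  In e (walk_edges (v :: LB')) \/ In e (walk_edges (b :: LT)).
Proof.
  unfold bridge_zigzag. rewrite (walk_edges_app _ _ _ _ _ PS), (walk_edges_app _ _ _ _ _ PA),
    (walk_edges_app _ _ _ _ _ PM), (walk_edges_app _ _ _ _ _ PB'), !in_app_iff. reflexivity.
Qed.

Lemma st_walk_upper : st_walk G X1.
Proof. apply st_walk_path. eexists. split; [reflexivity|exact path_upper]. Qed.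

Lemma st_walk_lower : st_walk G X2.
Proof. apply st_walk_path. eexists. split; [reflexivity|exact path_lower]. Qed.

Lemma st_walk_zigzag : st_walk G X3.
Proof. apply st_walk_path. eexists. split; [reflexivity|exact path_zigzag]. Qed.

Lemma part_ends : part s = 0%nat /\ part t = 8%nat.
Proof.
  destruct part_spec as (C0 & _ & _ & C8 & _). split; [apply C0; now left|].
  apply C8. exact (path_end_in _ _ _ _ PT).
Qed.

Lemma part_upper x : In x X1 -> part x <> 5%nat.
Proof.
  destruct part_spec as (C0 & C2 & C5 & C8 & C1 & C3 & _).
  change X1 with ((s :: LS) ++ LA ++ LA' ++ LT). rewrite !in_app_iff.
  intros [H|[H|[H|H]]].
  - rewrite C0 by exact H. discriminate.
  - destruct (Nat.eq_dec x u) as [->|N]; [rewrite C2; discriminate|rewrite C1 by auto; discriminate].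
  - destruct (Nat.eq_dec x b) as [->|N]; [rewrite C8 by now left|rewrite C3 by auto]; discriminate.
  - rewrite C8 by now right. discriminate.
Qed.

Lemma part_lower x : In x X2 -> part x <> 2%nat.
Proof.
  destruct part_spec as (C0 & C2 & C5 & C8 & _ & _ & C4 & C6 & _).
  change X2 with ((s :: LS) ++ LB ++ LB' ++ LT). rewrite !in_app_iff.
  intros [H|[H|[H|H]]].
  - rewrite C0 by exact H. discriminate.
  - destruct (Nat.eq_dec x v) as [->|N]; [rewrite C5; discriminate|rewrite C4 by auto; discriminate].
  - destruct (Nat.eq_dec x b) as [->|N]; [rewrite C8 by now left|rewrite C6 by auto]; discriminate.
  - rewrite C8 by now right. discriminate.
Qed.

Lemma count_bridge :
  count_occ Nat.eq_dec X1 u = 1%nat /\ count_occ Nat.eq_dec X1 v = 0%nat /\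
  count_occ Nat.eq_dec X2 u = 0%nat /\ count_occ Nat.eq_dec X2 v = 1%nat /\
  count_occ Nat.eq_dec X3 u = 1%nat /\ count_occ Nat.eq_dec X3 v = 1%nat.
Proof.
  destruct part_spec as (_ & C2 & C5 & _). destruct bridge_distinct as (_ & _ & _ & Vm).
  repeat split; try (apply NoDup_count_occ'; [auto using NoDup_upper, NoDup_lower, NoDup_zigzag|]);
    try (apply count_occ_not_In; intros H).
  - right. rewrite !in_app_iff. auto.
  - now apply part_upper in H.
  - now apply part_lower in H.
  - right. rewrite !in_app_iff. auto.
  - right. rewrite !in_app_iff. auto.
  - right. rewrite !in_app_iff. auto.
Qed.

Lemma upper_neq_lower : X1 <> X2.
Proof.
  intros E. destruct count_bridge as (E1 & _ & E2 & _). rewrite E in E1. congruence.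
Qed.

(** In the union of the three walks, [u] and [v] get charge 1 and all other vertices are unbounded.
    Upper and lower walk together have value 2, while the zigzag consumes both charges with a single
    unit. *)
Lemma bridge_weak : exists H, subgraph H G /\ weak H.
Proof.
  set (ps := [X1; X2; X3]).
  assert (Wps : forall p, In p ps -> st_walk G p).
  { intros p [<-|[<-|[<-|[]]]]; auto using st_walk_upper, st_walk_lower, st_walk_zigzag. }
  pose proof (walks_subgraph G ps HG ltac:(discriminate) Wps) as HH.
  set (H := mkG _ _ _ _) in HH. exists H. split; [exact HH|].
  destruct part_ends as [Cs Ct]. destruct part_spec as (_ & C2 & C5 & _).
  assert (EH : forall e, In e (gE H) <-> In e (walk_edges X1) \/ In e (walk_edges X2) \/ In e (walk_edges X3)).
  { intros e. simpl. rewrite nodup_In, !in_app_iff. simpl; tauto. }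
  assert (WH : forall p, In p ps -> st_walk H p).
  { intros p Hp. destruct (proj1 (st_walk_path _ _) (Wps p Hp)) as (q & -> & Q).
    apply st_walk_path. exists q. split; [reflexivity|].
    eapply path_incl; [|exact (path_self _ _ _ _ Q)]. intros e He. apply EH.
    destruct Hp as [E|[E|[E|[]]]]; rewrite E; auto. }
  assert (Key : forall p, st_walk H p -> (1 <= count_occ Nat.eq_dec p u + count_occ Nat.eq_dec p v)%nat).
  { intros p Hp. apply st_walk_path in Hp as (q & -> & Q).
    (* The parts 3, 6 and 8 lie behind [u] and [v]: in [H] they can be entered only by an edge that
       leaves [u] or [v]. *)
    destruct (path_crosses_cut _ _ _ _
      (fun x => match part x with 3 | 6 | 8 => true | _ => false end) Q) as (c & d & Hcd & Hc & Hd).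
    { change (gs H) with s. now rewrite Cs. }
    { change (gt H) with t. now rewrite Ct. }
    assert (He : In (c, d) (gE H)) by (eapply path_edges; eauto).
    assert (Hcuv : part c = 2%nat \/ part c = 5%nat).
    { apply EH in He. rewrite walk_edges_upper, walk_edges_lower, walk_edges_zigzag in He.
      destruct (edge_parts c d) as (E0 & E1 & E2 & E3 & E4 & E5 & E6).
      destruct (part c) as [|[|[|[|[|[|[|[|[|]]]]]]]]], (part d) as [|[|[|[|[|[|[|[|[|]]]]]]]]];
        try discriminate; auto; exfalso; intuition discriminate. }
    apply walk_edges_vertices in Hcd as [Hin _].
    destruct Hcuv as [E|E]; [apply part_2 in E|apply part_5 in E]; subst c;
      apply (count_occ_In Nat.eq_dec) in Hin; lia. }
  assert (Su : s <> u) by (intros E; rewrite E, C2 in Cs; discriminate).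
  assert (Sv : s <> v) by (intros E; rewrite E, C5 in Cs; discriminate).
  assert (Tu : t <> u) by (intros E; rewrite E, C2 in Ct; discriminate).
  assert (Tv : t <> v) by (intros E; rewrite E, C5 in Ct; discriminate).
  destruct count_bridge as (N1u & N1v & N2u & N2v & N3u & N3v).
  set (eta x := if Nat.eq_dec x u then Some 1%nat else if Nat.eq_dec x v then Some 1%nat else None).
  assert (Eu : eta u = Some 1%nat) by (unfold eta; now destruct (Nat.eq_dec u u)).
  assert (Ev : eta v = Some 1%nat).
  { unfold eta. destruct (Nat.eq_dec v u); [auto|]. now destruct (Nat.eq_dec v v). }
  assert (Vuv : In u (gV H) /\ In v (gV H)).
  { split; apply nodup_In, in_concat; [exists X1|exists X2]; split; try (simpl; tauto);
      apply (count_occ_In Nat.eq_dec); lia. }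
  destruct Vuv as [Vu Vv].
  assert (Fits : forall n, (n u <= 1)%nat -> (n v <= 1)%nat -> forall w, fits (eta w) (n w)).
  { intros n Hnu Hnv w. unfold eta. destruct (Nat.eq_dec w u) as [->|]; [exact Hnu|].
    destruct (Nat.eq_dec w v) as [->|]; [exact Hnv|exact I]. }
  assert (F12 : flow_for H eta (unit_flow [X1; X2]) [X1; X2]).
  { split.
    - apply unit_flow_nflow; [|intros p [<-|[<-|[]]]; apply WH; simpl; auto].
      repeat constructor; simpl; [|tauto]. intros [E|[]]. now apply upper_neq_lower.
    - intros w _. apply (Fits (nload (unit_flow [X1; X2]) [X1; X2]));
        rewrite unit_flow_load; unfold sumN, fold_right; lia. }
  assert (F3 : flow_for H eta (unit_flow [X3]) [X3]).
  { split.
    - apply unit_flow_nflow; [|intros p [<-|[]]; apply WH; simpl; auto].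
      repeat constructor; simpl; tauto.
    - intros w _. apply (Fits (nload (unit_flow [X3]) [X3]));
        rewrite unit_flow_load; unfold sumN, fold_right; lia. }
  (* Summing [Key] over a flow. With [eta] this gives the maximum 2; with the residual charges of
     the zigzag it gives the value 0. *)
  assert (Bound : forall eta' phi sp, flow_for H eta' phi sp ->
            (nvalue phi sp <= nload phi sp u + nload phi sp v)%nat).
  { intros eta' phi sp [(_ & W & _) _]. apply sumN_le_plus. intros p Hp.
    specialize (Key p (W p Hp)). nia. }
  exists eta, 1%nat, 2%nat. unfold channel, is_min_eta, is_max_eta.
  repeat match goal with |- _ /\ _ => split end.
  - change (eta s = None). unfold eta. destruct (Nat.eq_dec s u); [easy|]. now destruct (Nat.eq_dec s v).
  - change (eta t = None). unfold eta. destruct (Nat.eq_dec t u); [easy|]. now destruct (Nat.eq_dec t v).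
  - exists (unit_flow [X3]), [X3]. split; [|apply unit_flow_value]. split; [exact F3|].
    intros (psi & sp & Hpsi & Hpos).
    pose proof (Bound _ _ _ Hpsi) as Hb. destruct Hpsi as [_ Hr].
    pose proof (Hr u Vu) as Ru. pose proof (Hr v Vv) as Rv.
    unfold residual in Ru, Rv. rewrite Eu in Ru. rewrite Ev in Rv.
    rewrite unit_flow_load in Ru, Rv. unfold sumN, fold_right in Ru, Rv.
    rewrite N3u in Ru. rewrite N3v in Rv. simpl in Ru, Rv. lia.
  (* A flow of value 0 leaves all charges intact, so the zigzag still fits and nothing is
     inhibited. *)
  - intros phi sp [Hf Hinh]. destruct (nvalue phi sp) as [|n] eqn:En; [exfalso|lia].
    apply Hinh. exists (unit_flow [X3]), [X3]. split; [|rewrite unit_flow_value; simpl; lia].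
    destruct F3 as [F3 F3']. split; [exact F3|]. intros w Hw. specialize (F3' w Hw).
    unfold residual. destruct (eta w) as [k|]; [|exact I].
    assert (Z : nload phi sp w = 0%nat).
    { clear - En. unfold nload. pose proof (sumN_zero_inv _ _ En) as Z.
      rewrite (sumN_ext _ (fun _ => 0%nat)); [clear; induction sp; simpl; auto|].
      intros p Hp. rewrite (Z p Hp). lia. }
    rewrite Z, Nat.sub_0_r. exact F3'.
  - exists (unit_flow [X1; X2]), [X1; X2]. split; [exact F12|apply unit_flow_value].
  - intros phi sp Hphi. pose proof (Bound _ _ _ Hphi) as Hb. destruct Hphi as [_ Hr].
    pose proof (Hr u Vu) as Ru. pose proof (Hr v Vv) as Rv.
    rewrite Eu in Ru. rewrite Ev in Rv. simpl in Ru, Rv. lia.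
  - discriminate.
Qed.

(** * Edge flows and latencies on the bridge *)

Lemma in_upper_of_zigzag c d :
  In (c, d) (walk_edges X3) -> part c = 0%nat -> In (c, d) (walk_edges X1).
Proof.
  rewrite walk_edges_upper, walk_edges_zigzag. intros H E.
  destruct (edge_parts c d) as (_ & _ & _ & _ & E4 & E5 & E6).
  rewrite E in *. intuition discriminate.
Qed.

(** Hence the load-dependent latencies of Braess's example occur only on the zigzag, and all edges
    off it have constant latency. *)
Lemma special_edge c d :
  In (c, d) (walk_edges X1) \/ In (c, d) (walk_edges X2) \/ In (c, d) (walk_edges X3) ->
  part d = 2%nat \/ part c = 5%nat -> In (c, d) (walk_edges X3).
Proof.
  rewrite walk_edges_upper, walk_edges_lower, walk_edges_zigzag. intros H Sp.
  destruct (edge_parts c d) as (E0 & E1 & E2 & E3 & E4 & E5 & E6).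
  destruct Sp as [Sp|Sp]; rewrite Sp in *; intuition discriminate.
Qed.

Lemma ecount_zigzag e : In e (walk_edges X3) -> ecount e X3 = 1%nat.
Proof.
  intros H. pose proof (ecount_pos _ _ H). pose proof (ecount_le_1 e X3 NoDup_zigzag). lia.
Qed.

Lemma ecount_upper e : In e (walk_edges X1) -> ecount e X1 = 1%nat.
Proof.
  intros H. pose proof (ecount_pos _ _ H). pose proof (ecount_le_1 e X1 NoDup_upper). lia.
Qed.

Lemma ecount_lower e : In e (walk_edges X2) -> ecount e X2 = 1%nat.
Proof.
  intros H. pose proof (ecount_pos _ _ H). pose proof (ecount_le_1 e X2 NoDup_lower). lia.
Qed.

Lemma edge_load_one k p e : k p = 1 -> edge_load k [p] e = INR (ecount e p).
Proof. intros E. unfold edge_load, sumR, fold_right. rewrite E. lra. Qed.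

Lemma edge_load_two k x p q e : k p = x -> k q = x ->
  edge_load k [p; q] e = x * (INR (ecount e p) + INR (ecount e q)).
Proof. intros E E'. unfold edge_load, sumR, fold_right. rewrite E, E'. lra. Qed.

(** The capacities are the least ones that admit both the zigzag flow [f] and the sum [g] of the
    upper and lower flows; in particular they vanish off the three walks. The zigzag saturates a cut
    although its value is 1: it crosses that cut twice forwards and once backwards. *)
Lemma bridge_edge_weak : edge_weak G.
Proof.
  pose proof HG as (_ & ND & _ & _ & _ & _ & Hs & _).
  set (one := fun _ : list nat => 1).
  set (f := edge_load one [X3]). set (g := edge_load one [X1; X2]).
  set (c e := Rmax (f e) (g e)).
  assert (W3 : forall p, In p [X3] -> st_walk G p).
  { intros p [<-|[]]; apply st_walk_zigzag. }
  assert (W12 : forall p, In p [X1; X2] -> st_walk G p).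
  { intros p [<-|[<-|[]]]; [apply st_walk_upper|apply st_walk_lower]. }
  assert (Pone : forall p, 0 <= one p) by (intros; unfold one; lra).
  assert (Pf : forall e, 0 <= f e) by (intros; now apply edge_load_nonneg).
  assert (Pg : forall e, 0 <= g e) by (intros; now apply edge_load_nonneg).
  assert (Fe : forall e, f e = INR (ecount e X3)) by (intros; now apply edge_load_one).
  assert (Ge : forall e, g e = INR (ecount e X1) + INR (ecount e X2)).
  { intros. unfold g. rewrite (edge_load_two _ 1) by reflexivity. lra. }
  assert (Cons : forall l, (forall p, In p l -> st_walk G p) ->
            forall w, In w (gV G) -> w <> gs G -> w <> gt G ->
            in_sum G (edge_load one l) w = out_sum G (edge_load one l) w).
  { intros l Wl w Hw Nws Nwt. unfold in_sum, out_sum.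
    rewrite <- !flux_NoDup by exact ND. now apply flux_load_conserved. }
  assert (Vf : evalue G f = 1).
  { unfold f. rewrite evalue_flux, flux_load_value by auto. unfold one; simpl; lra. }
  assert (Vg : evalue G g = 2).
  { unfold g. rewrite evalue_flux, flux_load_value by auto. unfold one; simpl; lra. }
  assert (Ff : eflow G c f).
  { split; [|now apply Cons]. intros e _. split; [apply Pf|apply Rmax_l]. }
  assert (Fg : eflow G c g).
  { split; [|now apply Cons]. intros e _. split; [apply Pg|apply Rmax_r]. }
  exists c, f, 2. split; [|split; [exact Ff|split; [|split; [split|lra]]]].
  - intros e _. eapply Rle_trans; [apply (Pf e)|apply Rmax_l].
  - intros p Hp. apply st_walk_path in Hp as (q & -> & Q).
    destruct part_ends as [Cs Ct].
    (* The source side consists of the parts 0, 4 and 5. A forward edge of this cut on one of the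
       three walks lies on the arm into [u] or on the arm out of [v]; there the zigzag carries the
       same unit as the upper or the lower walk, so [g <= f]. On all other forward edges [g]
       vanishes. *)
    destruct (path_crosses_cut _ _ _ _
      (fun x => match part x with 0 | 4 | 5 => false | _ => true end) Q) as (x & y & Hxy & Hx & Hy).
    { fold s. now rewrite Cs. }
    { fold t. now rewrite Ct. }
    exists (x, y). split; [exact Hxy|]. unfold c. symmetry. apply Rmax_left.
    destruct (edge_parts x y) as (E0 & E1 & E2 & E3 & E4 & E5 & E6).
    pose proof (walk_edges_upper (x, y)) as H1. pose proof (walk_edges_lower (x, y)) as H2.
    pose proof (walk_edges_zigzag (x, y)) as H3.
    rewrite Ge, Fe.
    destruct (in_dec edge_eq_dec (x, y) (walk_edges X1)) as [I1|I1];
      [|rewrite (ecount_zero _ _ I1)];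
    (destruct (in_dec edge_eq_dec (x, y) (walk_edges X2)) as [I2|I2];
      [|rewrite (ecount_zero _ _ I2)]).
    + exfalso. apply H1 in I1. apply H2 in I2. clear H1 H2 H3.
      destruct (part x) as [|[|[|[|[|[|[|[|[|]]]]]]]]], (part y) as [|[|[|[|[|[|[|[|[|]]]]]]]]];
        try discriminate; intuition discriminate.
    + rewrite ecount_upper, ecount_zigzag by (auto; apply H3; apply H1 in I1; clear H1 H2 H3 I2;
        destruct (part x) as [|[|[|[|[|[|[|[|[|]]]]]]]]], (part y) as [|[|[|[|[|[|[|[|[|]]]]]]]]];
        try discriminate; intuition discriminate).
      simpl; lra.
    + rewrite ecount_lower, ecount_zigzag by (auto; apply H3; apply H2 in I2; clear H1 H2 H3 I1;
        destruct (part x) as [|[|[|[|[|[|[|[|[|]]]]]]]]], (part y) as [|[|[|[|[|[|[|[|[|]]]]]]]]];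
        try discriminate; intuition discriminate).
      simpl; lra.
    + pose proof (pos_INR (ecount (x, y) X3)). simpl; lra.
  - exists g. auto.
  - intros h [Bh _]. rewrite <- Vg, !evalue_flux by exact HG. apply sumR_le.
    intros [x y] He. apply filter_In in He as [He Hx]. apply nodup_In in He.
    apply Nat.eqb_eq in Hx. simpl in Hx. subst x.
    (* The edges at the source form a cut of capacity 2: a zigzag edge there is also on the upper
       walk, so [f <= g] and the capacity is that of [g]. *)
    eapply Rle_trans; [apply (Bh _ He)|]. unfold c. rewrite Rmax_right; [lra|].
    rewrite Fe. destruct (in_dec edge_eq_dec (gs G, y) (walk_edges X3)) as [I3|I3].
    + rewrite ecount_zigzag by exact I3. apply in_upper_of_zigzag in I3; [|apply part_ends].
      rewrite Ge, ecount_upper by exact I3. pose proof (pos_INR (ecount (gs G, y) X2)). simpl; lra.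
    + rewrite ecount_zero by exact I3. apply Pg.
Qed.

(* Braess's latencies: the load itself on the edge into [u] and on the edge out of [v],
   constant on all other edges. [level] is the equilibrium distance from [s] in [G], where all
   traffic takes the zigzag path; [level_split] the one without the bridge, where the
   traffic is split evenly. *)
Definition level (k : nat) : R :=
  match k with 0 | 1 => 0 | 3 | 6 | 8 => 2 | _ => 1 end.

Definition level_split (k : nat) : R :=
  match k with 0 | 1 => 0 | 2 => 1 / 2 | 3 | 6 | 8 => 3 / 2 | _ => 1 end.

Definition bridge_latency (e : nat * nat) : R -> R :=
  if in_dec edge_eq_dec e (walk_edges X1 ++ walk_edges X2 ++ walk_edges X3) then
    if orb (Nat.eqb (part (snd e)) 2) (Nat.eqb (part (fst e)) 5) then fun x => x
    else fun _ => level (part (snd e)) - level (part (fst e))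
  else fun _ => 2.

(** Justifies the latency 2 off the three walks: it is at least every difference of levels, so no
    outside edge is a shortcut. *)
Lemma level_bounds k : 0 <= level k <= 2.
Proof. do 9 (destruct k as [|k]; [simpl; lra|]). simpl; lra. Qed.

(** The constant latencies are differences of levels and must not be negative. On the load-dependent
    edges the level rises by 1, the load that the zigzag puts there. *)
Lemma level_mono c d :
  In (c, d) (walk_edges X1) \/ In (c, d) (walk_edges X2) \/ In (c, d) (walk_edges X3) ->
  level (part c) <= level (part d) /\
  (part d = 2%nat \/ part c = 5%nat -> level (part d) - level (part c) = 1).
Proof.
  rewrite walk_edges_upper, walk_edges_lower, walk_edges_zigzag. intros H.
  destruct (edge_parts c d) as (E0 & E1 & E2 & E3 & E4 & E5 & E6).
  assert (K : (part c = 0%nat \/ part c = 1%nat) /\ (part d = 0%nat \/ part d = 1%nat \/ part d = 2%nat) \/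
    (part c = 2%nat \/ part c = 3%nat) /\ (part d = 3%nat \/ part d = 8%nat) \/
    (part c = 0%nat \/ part c = 4%nat) /\ (part d = 4%nat \/ part d = 5%nat) \/
    (part c = 5%nat \/ part c = 6%nat) /\ (part d = 6%nat \/ part d = 8%nat) \/
    (part c = 2%nat \/ part c = 7%nat) /\ (part d = 7%nat \/ part d = 5%nat) \/
    part c = 8%nat /\ part d = 8%nat) by tauto.
  clear - K.
  split; [|intros Sp]; repeat match goal with
    | H : _ \/ _ |- _ => destruct H | H : _ /\ _ |- _ => destruct H
    | H : part _ = _ |- _ => rewrite H in * end; try discriminate; simpl; lra.
Qed.

Lemma bridge_latencies : latencies G bridge_latency.
Proof.
  intros [c d] _. unfold bridge_latency.
  assert (Kid : forall x, continue_in (fun x : R => x) (fun y => 0 <= y) x).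
  { intros x eps He. exists eps. split; [exact He|]. intros y [_ Hy]. exact Hy. }
  assert (Kc : forall k x, continue_in (fun _ : R => k) (fun y => 0 <= y) x).
  { intros k x eps He. exists 1. split; [lra|]. intros y _. simpl.
    unfold Rdist. rewrite Rminus_diag, Rabs_R0. exact He. }
  destruct (in_dec edge_eq_dec _ _) as [Hin|Hin]; [destruct (orb _ _)|]; repeat split; auto; intros; try lra.
  simpl. rewrite !in_app_iff in Hin. apply level_mono in Hin. lra.
Qed.


(** One unit of traffic is routed. In [G] it takes the zigzag at latency 2; in [H], the union of the
    upper and lower walks, it splits evenly at latency 3/2. [level] and [level_split] are the
    potentials that certify the two equilibria. *)
Lemma bridge_vulnerable : vulnerable G.
Proof.
  set (k3 p := INR (unit_flow [X3] p)).
  set (k12 p := / 2 * INR (unit_flow [X1; X2] p)).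
  assert (W12 : forall p, In p [X1; X2] -> st_walk G p).
  { intros p [<-|[<-|[]]]; [apply st_walk_upper|apply st_walk_lower]. }
  pose proof (walks_subgraph G [X1; X2] HG ltac:(discriminate) W12) as HH.
  set (H := mkG _ _ _ _) in HH.
  destruct part_ends as [Cs Ct].
  assert (EH : forall e, In e (gE H) <-> In e (walk_edges X1) \/ In e (walk_edges X2)).
  { intros e. simpl. rewrite nodup_In, !in_app_iff. simpl; tauto. }
  assert (WH : forall p, In p [X1; X2] -> st_walk H p).
  { intros p Hp. destruct (proj1 (st_walk_path _ _) (W12 p Hp)) as (q & -> & Q).
    apply st_walk_path. exists q. split; [reflexivity|].
    eapply path_incl; [|exact (path_self _ _ _ _ Q)]. intros e He. apply EH.
    destruct Hp as [E|[E|[]]]; rewrite E; auto. }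
  assert (U : forall l p, In p l -> unit_flow l p = 1%nat).
  { intros l p Hp. unfold unit_flow. now destruct (in_dec (list_eq_dec Nat.eq_dec) p l). }
  assert (U0 : forall l p, INR (unit_flow l p) <> 0 -> In p l).
  { intros l p Hp. unfold unit_flow in Hp. now destruct (in_dec (list_eq_dec Nat.eq_dec) p l). }
  assert (K3 : k3 X3 = 1) by (unfold k3; rewrite U; simpl; auto).
  assert (K1 : k12 X1 = / 2) by (unfold k12; rewrite U; simpl; auto; lra).
  assert (K2 : k12 X2 = / 2) by (unfold k12; rewrite U; simpl; auto; lra).
  set (l := bridge_latency).
  set (L3 e := l e (edge_load k3 [X3] e)).
  set (L12 e := l e (edge_load k12 [X1; X2] e)).
  assert (Z3 : forall e, In e (walk_edges X3) -> L3 e = level (part (snd e)) - level (part (fst e))).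
  { intros [c d] He. unfold L3, l, bridge_latency.
    rewrite (edge_load_one _ _ _ K3), (ecount_zigzag _ He).
    destruct (in_dec edge_eq_dec _ _) as [Hin|Hin]; [|destruct Hin; rewrite !in_app_iff; auto].
    destruct (orb _ _) eqn:Sp; [|reflexivity].
    apply Bool.orb_true_iff in Sp. rewrite !Nat.eqb_eq in Sp. symmetry.
    now apply level_mono; auto. }
  (* Off the zigzag the latency is a difference of levels or the constant 2, so [level] is a
     feasible potential on all of [G]. *)
  assert (ZG : forall e, level (part (snd e)) - level (part (fst e)) <= L3 e).
  { intros [c d]. destruct (in_dec edge_eq_dec (c, d) (walk_edges X3)) as [I3|I3]; [rewrite Z3 by exact I3; lra|].
    unfold L3, l, bridge_latency. cbn [fst snd].
    destruct (in_dec edge_eq_dec _ _) as [Hin|Hin].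
    - destruct (orb _ _) eqn:Sp; [|apply Rle_refl]. exfalso. apply I3.
      apply Bool.orb_true_iff in Sp. rewrite !Nat.eqb_eq in Sp.
      rewrite !in_app_iff in Hin. now apply special_edge.
    - pose proof (level_bounds (part c)). pose proof (level_bounds (part d)). cbv beta. lra. }
  assert (ZH : forall e, In e (gE H) -> L12 e = level_split (part (snd e)) - level_split (part (fst e))).
  { intros [c d] He. apply EH in He. unfold L12, l, bridge_latency. cbn [fst snd].
    rewrite (edge_load_two _ _ _ _ _ K1 K2).
    destruct (in_dec edge_eq_dec _ _) as [Hin|Hin]; [|destruct Hin; rewrite !in_app_iff; tauto].
    destruct (edge_parts c d) as (E0 & E1 & E2 & E3 & E4 & E5 & E6). clear Hin.
    destruct He as [He|He]; pose proof He as He'.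
    - rewrite (ecount_upper _ He).
      (* A load-dependent edge lies on only one of the two walks and thus carries one half, which is
         the increment of [level_split] there. *)
      assert (N2 : part d = 2%nat \/ part c = 5%nat -> ecount (c, d) X2 = 0%nat).
      { intros Sp. apply ecount_zero. intros I2.
        apply walk_edges_vertices in I2 as [I2 I2'], He as [J1 J2].
        destruct Sp as [Sp|Sp]; [eapply part_lower; [|exact Sp]; now right|].
        now apply (part_upper c). }
      apply walk_edges_upper in He'.
      assert (K : (part c = 0%nat \/ part c = 1%nat) /\ (part d = 0%nat \/ part d = 1%nat \/ part d = 2%nat) \/
        (part c = 2%nat \/ part c = 3%nat) /\ (part d = 3%nat \/ part d = 8%nat) \/
        part c = 8%nat /\ part d = 8%nat) by tauto.
      clear - K N2. decompose [and or] K; match goal with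
        | A : part c = _, B : part d = _ |- _ => rewrite A, B; rewrite A, B in N2 end;
        simpl; rewrite ?N2 by auto; simpl; lra.
    - rewrite (ecount_lower _ He).
      assert (N1 : part d = 2%nat \/ part c = 5%nat -> ecount (c, d) X1 = 0%nat).
      { intros Sp. apply ecount_zero. intros I2.
        apply walk_edges_vertices in I2 as [I2 I2'], He as [J1 J2].
        destruct Sp as [Sp|Sp]; [eapply part_lower; [|exact Sp]; now right|].
        now apply (part_upper c). }
      apply walk_edges_lower in He'.
      assert (K : part c = 0%nat /\ part d = 0%nat \/
        (part c = 0%nat \/ part c = 4%nat) /\ (part d = 4%nat \/ part d = 5%nat) \/
        (part c = 5%nat \/ part c = 6%nat) /\ (part d = 6%nat \/ part d = 8%nat) \/
        part c = 8%nat /\ part d = 8%nat) by tauto.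
      clear - K N1. decompose [and or] K; match goal with
        | A : part c = _, B : part d = _ |- _ => rewrite A, B; rewrite A, B in N1 end;
        simpl; rewrite ?N1 by auto; simpl; lra. }
  assert (P3 : path_lat l k3 [X3] X3 = 2).
  { unfold path_lat. fold L3. change X3 with (s :: LS ++ LA ++ LM ++ LB' ++ LT).
    rewrite (path_potential_eq _ _ _ _ (fun x => level (part x)) L3 path_zigzag Z3).
    rewrite Cs, Ct. simpl; lra. }
  assert (PG : forall p, st_walk G p -> 2 <= path_lat l k3 [X3] p).
  { intros p Hp. apply st_walk_path in Hp as (q & -> & Q).
    pose proof (path_potential_le _ _ _ _ (fun x => level (part x)) L3 Q (fun e _ => ZG e)) as Hle.
    fold s t in Hle. cbv beta in Hle. rewrite Cs, Ct in Hle. simpl level in Hle.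
    unfold path_lat. fold L3 s. lra. }
  (* Every edge of [H] is tight for [level_split], so all walks of [H] have the same latency and the
     Wardrop condition is an equality. *)
  assert (PH : forall p, st_walk H p -> path_lat l k12 [X1; X2] p = 3 / 2).
  { intros p Hp. apply st_walk_path in Hp as (q & -> & Q). unfold path_lat. fold L12.
    rewrite (path_potential_eq _ _ _ _ (fun x => level_split (part x)) L12 Q).
    - change (gt H) with t. change (gs H) with s. rewrite Cs, Ct. simpl; lra.
    - intros e He. apply ZH. eapply path_edges; eauto. }
  exists 1, l, H, 2, (3 / 2). repeat match goal with |- _ /\ _ => split end; [lra|apply bridge_latencies|exact HH| | |lra].
  - exists k3, [X3]. split; [|split; [|lra]].
    + split; [|split].
      * split; [apply NoDup_cons; [easy|apply NoDup_nil]|split; [|split]].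
        -- intros p [<-|[]]; apply st_walk_zigzag.
        -- intros p Hp. now apply U0.
        -- intros p. apply pos_INR.
      * unfold sumR, fold_right. lra.
      * intros p q [<-|[]] _ Hq. rewrite P3. now apply PG.
    + intros p [<-|[]] _. exact P3.
  - exists k12, [X1; X2]. split; [|split; [|lra]].
    + split; [|split].
      * split; [|split; [exact WH|split]].
        -- apply NoDup_cons; [|apply NoDup_cons; [easy|apply NoDup_nil]].
           intros [E|[]]. now apply upper_neq_lower.
        -- intros p Hp. apply U0. intros E. apply Hp. unfold k12. rewrite E. lra.
        -- intros p. unfold k12. pose proof (pos_INR (unit_flow [X1; X2] p)). lra.
      * unfold sumR, fold_right. lra.
      * intros p q Hp _ Hq. rewrite (PH q Hq), PH by auto. lra.
    + intros p Hp _. now apply PH, WH.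
Qed.

End Bridge.

Lemma wheatstone_bridge G : st_graph G -> no_cycle (gE G) -> wheatstone (gE G) ->
  vulnerable G /\ edge_weak G /\ exists H, subgraph H G /\ weak H.
Proof.
  intros HG Hac (a & b & P & Q & u0 & v0 & M & HP & HQ & HPQ & Hu0 & Nu0 & Hv0 & Nv0 & HM).
  (* [v0] reaches [b] along [Q], so by acyclicity [b] does not reach [v0]. The ends of the trimmed
     bridge do reach [v0] and hence still differ from [b]. *)
  assert (Db : forall w r, path (gE G) w r v0 -> w <> b).
  { intros w r Hr ->. apply Nv0.
    destruct (path_split _ _ _ _ v0 HQ) as (q1 & q2 & _ & _ & Q2); [now right|].
    eapply no_cycle_antisym; eauto. }
  destruct (last_hit _ (fun z => In z P) (fun z => in_dec Nat.eq_dec z P) _ _ _ HM Hu0)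
    as (u & m1 & m2 & -> & M1 & M2 & Hu & Hm2).
  destruct (first_hit _ (fun z => In z Q) (fun z => in_dec Nat.eq_dec z Q) _ _ _ M2 Hv0)
    as (v & m3 & m4 & -> & M3 & M4 & Hv & Hm3 & _).
  assert (Nub : u <> b) by (eapply Db; exact M2).
  assert (Nvb : v <> b) by (eapply Db; exact M4).
  destruct (path_split_tail _ _ _ _ _ HP Hu) as (P1 & PA' & -> & HA & HA').
  destruct (path_split_tail _ _ _ _ _ HQ Hv) as (Q1 & PB' & -> & HB & HB').
  assert (Va : exists w, In (a, w) (gE G)).
  { destruct (P1 ++ u :: PA') as [|w r] eqn:E; [now destruct P1|].
    apply path_cons_inv in HP as [? _]. eauto. }
  destruct Va as [w Hw]. apply (st_graph_ends G HG) in Hw as [Va _].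
  assert (Vb : In b (gV G)).
  { destruct (path_in_edge _ _ _ _ b HP) as [z Hz].
    - rewrite in_app_iff. right. right. apply (path_end_tail _ _ _ _ HA'). auto.
    - now apply (st_graph_ends G HG) in Hz. }
  destruct (st_graph_from G HG a Va) as [LS PS]. destruct (st_graph_to G HG b Vb) as [LT PT].
  assert (EP : P1 ++ u :: PA' = (P1 ++ [u]) ++ PA') by (now rewrite <- app_assoc).
  assert (EQ : Q1 ++ v :: PB' = (Q1 ++ [v]) ++ PB') by (now rewrite <- app_assoc).
  rewrite EP, EQ in *.
  assert (Hm : forall z, In z m3 -> ~ In z ((P1 ++ [u]) ++ PA') /\
                 (In z ((Q1 ++ [v]) ++ PB') -> z = v)).
  { intros z Hz. split; [apply Hm2, in_app_iff; auto|]. intros Hz'. apply Hm3; [now right|exact Hz']. }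
  assert (Hu1 : In u (P1 ++ [u])) by (apply in_app_iff; simpl; auto).
  assert (Hv1 : In v (Q1 ++ [v])) by (apply in_app_iff; simpl; auto).
  split; [|split].
  - now apply (bridge_vulnerable G HG Hac a u v b LS (P1 ++ [u]) PA' (Q1 ++ [v]) PB' m3 LT).
  - now apply (bridge_edge_weak G HG Hac a u v b LS (P1 ++ [u]) PA' (Q1 ++ [v]) PB' m3 LT).
  - now apply (bridge_weak G HG Hac a u v b LS (P1 ++ [u]) PA' (Q1 ++ [v]) PB' m3 LT).
Qed.

Theorem theorem9 (G : graph) (HG : st_graph G) (Hac : acyclic G) :
  (vulnerable G <-> ~ TTSP G) /\
  (edge_weak G <-> ~ TTSP G) /\
  ((exists H, subgraph H G /\ weak H) <-> ~ TTSP G).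
Proof.
  apply acyclic_no_cycle in Hac.
  assert (B : ~ TTSP G -> vulnerable G /\ edge_weak G /\ exists H, subgraph H G /\ weak H).
  { intros N. destruct (TTSP_or_wheatstone G HG Hac) as [T|W]; [easy|].
    now apply wheatstone_bridge. }
  repeat split; try (intros N; now apply B).
  - intros V T. now apply (TTSP_not_vulnerable G).
  - intros V T. now apply (TTSP_not_edge_weak G).
  - intros (H & HH & W) T. now apply (TTSP_subgraph_not_weak G H).
Qed.
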